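(* There is an absolute constant $c_0$ such that the following holds. Let $\delta>0$ be fixed. Let $p$ be a prime and $e$ a positive integer with $e\mid p-1$ and $e\le p^{\delta}$. Given an oracle $\mathcal{O}_{e,s}$ for some unknown $s\in\mathbb{F}_p$ and a known element $t\in\mathbb{F}_p$, where querying the oracle at $x=-t$ is forbidden, there is a deterministic algorithm which decides whether $s=t$ in time $e^{c_0\delta}(\log p)^{O(1)}$.
   Context: For a prime $p$, a positive integer $e\mid p-1$ and a hidden element $s\in\mathbb{F}_p$, the oracle $\mathcal{O}_{e,s}$ is a black box which, on any input $x\in\mathbb{F}_p$, returns $(x+s)^e\in\mathbb{F}_p$. Running time counts bit operations, each oracle call having unit cost. *)

(* Defs.v *)
From Stdlib Require Import Reals.
From mathcomp Require Import all_boot.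

Set Implicit Arguments.
Unset Strict Implicit.
Unset Printing Implicit Defensive.

(* Oracle O_{e,s} over F_p, with F_p represented by {0,...,p-1} in nat.     *)
Definition oracle (p e s : nat) : nat -> nat := fun x => ((x + s) ^ e) %% p.

Definition forbidden (p t x : nat) : bool := (x + t) %% p == 0.

(* Binary encodings (little-endian; 0 is the empty word).                    *)
Fixpoint bits_aux (k n : nat) : seq bool :=
  match k with
  | 0 => [::]
  | k'.+1 => if n == 0 then [::] else odd n :: bits_aux k' n./2
  end.
Definition bits_of (n : nat) : seq bool := bits_aux n n.
Definition nat_of_bits (bs : seq bool) : nat :=
  foldr (fun (b : bool) acc => b + acc.*2) 0 bs.

(* Deterministic single-tape oracle Turing machines over {0,1,blank}.        *)
(* Each transition (including an oracle call and halting) costs one step.   *)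
Inductive move := MoveL | MoveR | Stay.

Inductive action (Q : Type) :=
  | Step of Q & option bool & move
  | Query of Q
  | Accept
  | Reject.
Arguments Accept {Q}.
Arguments Reject {Q}.

Record OTM := {
  state : finType;
  start : state;
  delta : state -> option bool -> action state
}.

(* tape: cells left of the head (nearest first), and cells from the head on *)
Record tape := Tape { tleft : seq (option bool); tright : seq (option bool) }.

Definition read (tp : tape) : option bool := head None (tright tp).
Definition write (w : option bool) (tp : tape) : tape :=
  Tape (tleft tp) (w :: behead (tright tp)).
Definition mv (m : move) (tp : tape) : tape :=
  match m with
  | Stay => tp
  | MoveR => Tape (head None (tright tp) :: tleft tp) (behead (tright tp))
  | MoveL => match tleft tp with
             | [::] => Tape [::] (None :: tright tp)
             | a :: l => Tape l (a :: tright tp)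
             end
  end.

Fixpoint bit_prefix (s : seq (option bool)) : seq bool :=
  match s with
  | Some b :: s' => b :: bit_prefix s'
  | _ => [::]
  end.

Definition query_val (tp : tape) : nat := nat_of_bits (bit_prefix (tright tp)).
Definition answer (O : nat -> nat) (tp : tape) : tape :=
  let bs := bit_prefix (tright tp) in
  Tape (tleft tp)
       (map Some (bits_of (O (nat_of_bits bs))) ++ drop (size bs) (tright tp)).

Fixpoint exec (M : OTM) (O : nat -> nat) (fuel : nat) (q : state M) (tp : tape)
  : option (bool * seq nat) :=
  match fuel with
  | 0 => None
  | n.+1 =>
    match delta q (read tp) with
    | Accept => Some (true, [::])
    | Reject => Some (false, [::])
    | Step q' w m => exec O n q' (mv m (write w tp))
    | Query q' =>
        match exec O n q' (answer O tp) with
        | Some (b, qs) => Some (b, query_val tp :: qs)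
        | None => None
        end
    end
  end.

Definition init_tape (p e t : nat) : tape :=
  Tape [::] (map Some (bits_of p) ++ None :: map Some (bits_of e) ++ None
               :: map Some (bits_of t)).

(* Main.v *)
(** Put [a = s - t].  Querying the oracle at [x - t], where [x] is the inverse
    of [z] mod [p], and comparing with [x ^ e] tests whether [1 + a z] lies in
    the group [G] of [e]-th roots of unity.  If [a <> 0], some [z] below a
    constant times [e ^ (1/m)], with [m] about [1 / (16 delta)], fails the test.
    Indeed suppose none does up to [h].  With [b = 1/a], the [n]-subsets [S] of
    [{1..h}], [n = 2m], have values [P_S(b)], [P_S = prod_(z in S) (X + z)], in
    a coset of [G], so many of them share a value, and as in the sunflower
    lemma many of those may be taken pairwise disjoint: [S_1, S_2, ...].  The
    polynomials [P_(S_i) - P_(S_1)] vanish at [b] mod [p] and have small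
    coefficients, so their resultants, being smaller than [p], vanish: each of
    them has a complex root [alpha] in common with [P_(S_2) - P_(S_1)].  If [f]
    is the integral minimal polynomial of [alpha] then
    [prod_(z in S_i) f(-z) = prod_(z in S_1) f(-z)] divides an integer that does
    not depend on [i].  By the divisor bound there are then too few possible
    elements [z] of the disjoint sets [S_i]. *)
Require Import Defs.
From Stdlib Require Import Reals.
From mathcomp Require Import all_boot.
From Stdlib Require Import Lra.
From mathcomp Require Import all_order all_algebra all_fingroup all_field zify.

Delimit Scope R_scope with Re.
Delimit Scope Z_scope with Zs.
Set Implicit Arguments.
Unset Strict Implicit.
Unset Printing Implicit Defensive.

(** * The divisor bound *)

(** The choice [n = 2 m] provides the margin: there are about [h ^ (2 m)] subsets and at most
    [e < h ^ m] values, so some class has about [h ^ m] members, whereas the divisor bound limits a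
    class to about [D ^ n] with [D] of order [h ^ (1/4)], that is [h ^ (m/2)]. The resultants have
    size about [h ^ (8 m ^ 2)], comparable with [e ^ (8 m)]; asking for [e ^ (16 m) <= p] leaves
    another [e ^ (8 m)] for the constants. For [delta >= 1/32] the choice is [m = 1], and counting
    the roots of [X ^ e - 1] suffices. On a single tape, [N] operations on stacks cost about [N ^ 2]
    steps, so [e ^ (1/m)] enters squared; with [1/m <= 32 delta] this yields [c0 = 64]. No root
    extraction takes place: [h] is a power of two obtained from the bit length of [e]. A predicate
    [ok] on queries is built into both program semantics, so that deriving a run already certifies
    its queries. *)

Lemma size_divisors_mul (q n : nat) : prime q -> 0 < n ->
  size (divisors n) <= (logn q n).+1 * size (divisors (n %/ q ^ logn q n)).
Proof.
move=> q_pr n0; set a := logn q n; set n' := n %/ _.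
have nE : n = q ^ a * n' by rewrite mulnC divnK // pfactor_dvdnn.
have n'0 : 0 < n' by rewrite divn_gt0 ?expn_gt0 ?prime_gt0 // dvdn_leq // pfactor_dvdnn.
pose s := [seq q ^ i * d | i <- iota 0 a.+1, d <- divisors n'].
have <- : size s = a.+1 * size (divisors n') by rewrite size_allpairs size_iota.
apply: uniq_leq_size; first exact: divisors_uniq.
move=> d; rewrite -dvdn_divisors // => dn.
have d0 : 0 < d by apply: dvdn_gt0 dn.
have [d' [d'E cop]] : exists d', d = q ^ logn q d * d' /\ coprime q d'.
  by have [d' cop dE] := pfactor_coprime q_pr d0; exists d'; rewrite mulnC.
apply/allpairsP; exists (logn q d, d'); split=> //.
  by rewrite mem_iota add0n ltnS dvdn_leq_log.
rewrite /= -dvdn_divisors //.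
have : d' %| q ^ a * n' by rewrite -nE (dvdn_trans _ dn) // d'E dvdn_mull.
by rewrite Gauss_dvdr // coprime_sym coprimeXl.
Qed.

(** Halving [a] to [b] leaves a spare factor [2 ^ b], which absorbs the additional factor [b.+1]. *)
Lemma expn_succ_bound (k : nat) : exists C, forall a, a.+1 ^ k <= C * 2 ^ a.
Proof.
elim: k => [|k [C IH]].
  by exists 1 => a; rewrite expn0 mul1n expn_gt0.
exists (2 ^ k.+1 * C) => a; set b := a./2.
have ab : a.+1 <= 2 * b.+1 by rewrite -[a in a.+1]odd_double_half -/b; case: (odd a); lia.
have ba : b.*2 <= a by rewrite -[X in _ <= X]odd_double_half -/b leq_addl.
apply: (@leq_trans ((2 * b.+1) ^ k.+1)); first by rewrite leq_exp2r.
rewrite expnMn -mulnA leq_mul2l; apply/orP; right.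
apply: (@leq_trans (C * 2 ^ b * 2 ^ b)).
  by rewrite expnSr leq_mul ?IH // ltn_expl.
by rewrite -mulnA leq_mul2l -expnD addnn leq_exp2l ?ba ?orbT.
Qed.

(** The bound [d(n) = n ^ o(1)] in a form free of real exponents; the induction strips the least
    prime factor with its full power. *)
Lemma divisor_bound (k : nat) : exists C, forall n, 0 < n -> size (divisors n) ^ k <= C * n.
Proof.
have [C0 HC0] := expn_succ_bound k.
pose C := C0.+1.
have HC a : a.+1 ^ k <= C * 2 ^ a by apply: leq_trans (HC0 a) _; rewrite leq_mul2r leqnSn orbT.
(* A prime power [q ^ a] with [2 ^ k <= q] satisfies [(a + 1) ^ k <= q ^ a], so only
   the primes below [2 ^ k] cost a factor [C]. *)
pose w n := count (fun q => q < 2 ^ k) (primes n).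
have main n : 0 < n -> size (divisors n) ^ k <= C ^ w n * n.
  elim/ltn_ind: n => n IH n0.
  have [n1|n1] := leqP n 1.
    have -> : n = 1 by lia.
    by rewrite /w /= exp1n.
  set q := pdiv n.
  have q_pr : prime q by apply: pdiv_prime.
  set a := logn q n; set n' := n %/ q ^ a.
  have nE : n = q ^ a * n' by rewrite mulnC divnK // pfactor_dvdnn.
  have a0 : 0 < a by rewrite logn_gt0 mem_primes q_pr n0 pdiv_dvd.
  have n'0 : 0 < n' by rewrite divn_gt0 ?expn_gt0 ?prime_gt0 // dvdn_leq // pfactor_dvdnn.
  have qa1 : 1 < q ^ a by rewrite -(expn0 q) ltn_exp2l // prime_gt1.
  have n'n : n' < n by rewrite [X in _ < X]nE; nia.
  have qn' : q \notin primes n'.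
    have [n2 cop n2E] := pfactor_coprime q_pr n0.
    have <- : n2 = n' by rewrite /n' [in RHS]n2E mulnK // expn_gt0 prime_gt0.
    rewrite mem_primes q_pr /= negb_and -prime_coprime // cop orbT //.
  have wE : w n' + (q < 2 ^ k) <= w n.
    rewrite /w -!size_filter addnC.
    have -> : (q < 2 ^ k) = size [seq r <- [:: q] | r < 2 ^ k] :> nat by rewrite /=; case: ifP.
    rewrite -size_cat -filter_cat; apply: uniq_leq_size.
      by rewrite filter_uniq //= qn' primes_uniq.
    move=> r; rewrite !mem_filter /= inE => /andP[-> /=] /orP[/eqP->|].
      by rewrite mem_primes q_pr n0 pdiv_dvd.
    rewrite !mem_primes n0 => /and3P[-> _ rn'] /=.
    by rewrite nE dvdn_mull.
  apply: (@leq_trans (a.+1 ^ k * size (divisors n') ^ k)).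
    by rewrite -expnMn; case: (k) => // k'; rewrite leq_exp2r // size_divisors_mul.
  have step : a.+1 ^ k <= C ^ (q < 2 ^ k) * q ^ a.
    have [qk|qk] := ltnP q (2 ^ k).
      rewrite expn1; apply: leq_trans (HC a) _.
      by rewrite leq_mul2l leq_exp2r // prime_gt1 ?orbT.
    rewrite expn0 mul1n.
    apply: (@leq_trans ((2 ^ k) ^ a)); last by rewrite leq_exp2r.
    rewrite -expnM mulnC expnM.
    by case: (k) => // k'; rewrite leq_exp2r // ltn_expl.
  apply: leq_trans (leq_mul step (IH _ n'n n'0)) _.
  by rewrite mulnACA -nE -expnD leq_mul2r leq_pexp2l ?orbT // addnC.
exists (C ^ 2 ^ k) => n n0; apply: leq_trans (main n n0) _.
rewrite leq_mul2r leq_pexp2l ?orbT // /w -size_filter.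
rewrite -[X in _ <= X](size_iota 0); apply: uniq_leq_size; first by rewrite filter_uniq ?primes_uniq.
by move=> r; rewrite mem_filter mem_iota => /andP[].
Qed.

(** * Translates of subgroups of the multiplicative group mod p *)

Section Translates.
Import Order.TTheory GRing.Theory Num.Theory.
Local Open Scope ring_scope.

(** * Resultants and common roots *)

Lemma normr_det_le (R : numDomainType) (n : nat) (A : 'M[R]_n) (H : R) :
  0 <= H -> (forall i j, `|A i j| <= H) -> `|\det A| <= (n`!)%:R * H ^+ n.
Proof.
move=> H0 AH; rewrite /determinant.
apply: le_trans (ler_norm_sum _ _ _) _.
have -> : (n`!)%:R * H ^+ n = \sum_(s : 'S_n) H ^+ n.
  by rewrite sumr_const card_Sn mulr_natl.
apply: ler_sum => s _; rewrite normrM normrX normrN1 expr1n mul1r normr_prod.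
rewrite -[X in H ^+ X]card_ord -prodr_const; apply: ler_prod => i _.
by rewrite normr_ge0 AH.
Qed.

Lemma resultant_bound (F G : {poly int}) (n H : nat) :
  (size F <= n.+1)%N -> (size G <= n.+1)%N ->
  (0 < H)%N -> (forall i, `|F`_i| <= H%:Z) -> (forall i, `|G`_i| <= H%:Z) ->
  `|resultant F G| <= ((2 * n)`! * H ^ (2 * n))%N%:Z.
Proof.
move=> sF sG H0 FH GH; rewrite /resultant.
apply: le_trans (normr_det_le (H := H%:Z) _ _) _ => //.
  move=> i j; rewrite Sylvester_mxE; case: (split i) => k; case: leqP => _;
  by rewrite ?mulr1n ?mulr0n ?normr0.
set d := (_ + _)%N; have dn : (d <= 2 * n)%N.
  have pr a : (a <= n.+1)%N -> (a.-1 <= n)%N by case: a.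
  by rewrite /d mul2n -addnn leq_add // pr.
have -> : H%:Z ^+ d = (H ^ d)%N%:Z by rewrite -!natz natrX.
rewrite natz -PoszM lez_nat.
by rewrite leq_mul ?leq_fact ?leq_pexp2l.
Qed.

(** The resultant lies in the ideal generated by [F] and [G], so it vanishes mod [p]; being smaller
    than [p], it is the integer 0, and the two polynomials share a nonconstant factor. *)
Lemma common_root (p : nat) (b : 'F_p) (F G : {poly int}) (n H : nat) :
  prime p -> (0 < n)%N -> (0 < H)%N ->
  (size F <= n.+1)%N -> (size G <= n.+1)%N -> F != 0 -> G != 0 ->
  (forall i, `|F`_i| <= H%:Z) -> (forall i, `|G`_i| <= H%:Z) ->
  root (map_poly intr F) b -> root (map_poly intr G) b ->
  ((2 * n)`! * H ^ (2 * n) < p)%N ->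
  exists2 x : algC, root (map_poly intr F) x & root (map_poly intr G) x.
Proof.
move=> p_pr n0 H0 sF sG F0 G0 FH GH Fb Gb ltp.
have Hp : (H < p)%N.
  apply: leq_ltn_trans ltp; apply: (@leq_trans (H ^ (2 * n))).
    by rewrite -[X in (X <= _)%N]expn1 leq_pexp2l // muln_gt0.
  by rewrite leq_pmull // fact_gt0.
have small_const (c : int) : `|c| < p%:Z -> c%:~R = 0 :> 'F_p -> c = 0.
  move=> cp /eqP; rewrite -(dvdz_pcharf (pchar_Fp p_pr)) => pc.
  apply/eqP; apply: contraLR pc => c0.
  rewrite dvdzE /= gtnNdvd ?absz_gt0 // -ltz_nat abszE.
(* A nonzero constant below [p] cannot vanish mod [p]; writing the resultant as a combination of [F]
   and [G] requires both to be nonconstant. *)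
have size_gt1 (K : {poly int}) : K != 0 -> (forall i, `|K`_i| <= H%:Z) ->
    root (map_poly intr K) b -> (1 < size K)%N.
  move=> K0 KH Kb; rewrite ltnNge; apply/negP=> /size1_polyC KE.
  move: Kb; rewrite KE map_polyC rootE hornerC /= => /eqP /small_const K00.
  have : K`_0 = 0 by apply: K00; apply: le_lt_trans (KH 0%N) _; rewrite ltz_nat.
  by move=> K0'; case/eqP: K0; rewrite KE K0'.
have [sF1 sG1] := (size_gt1 _ F0 FH Fb, size_gt1 _ G0 GH Gb).
have R0 : resultant F G = 0.
  apply: small_const.
    by apply: le_lt_trans (resultant_bound sF sG H0 FH GH) _; rewrite ltz_nat.
  have [[u v] /= _ RE] := resultant_in_ideal sF1 sG1.
  suff : (map_poly intr (resultant F G)%:P).[b] = 0 by rewrite map_polyC hornerC.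
  by rewrite RE rmorphD !rmorphM hornerD !hornerM (eqP Fb) (eqP Gb) !mulr0 addr0.
move/eqP: R0; rewrite resultant_eq0; set g := gcdp _ _ => sg.
have [x gx] : exists x : algC, root (map_poly intr g) x.
  apply/closed_rootP; rewrite size_map_poly_id0 ?gtn_eqF //.
  by rewrite intr_eq0 lead_coef_eq0 -size_poly_gt0 ltnW.
(* Over [int] the gcd divides only up to a nonzero scalar, which does not affect complex roots. *)
have transfer (K : {poly int}) : g %| K -> root (map_poly intr K) x.
  move=> /Pdiv.Idomain.dvdpP [[c q] /= c0 cK].
  have : root (map_poly intr (c *: K) : {poly algC}) x.
    by rewrite cK rmorphM /= rootM gx orbT.
  by rewrite map_polyZ /= rootZ // intr_eq0.
by exists x; apply: transfer; [apply: Pdiv.Idomain.dvdp_gcdl | apply: Pdiv.Idomain.dvdp_gcdr].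
Qed.

(** * The polynomials [P_S] and their values *)

(** The polynomial [P_S]: the ordinal [i] stands for the element [i.+1] of [{1..h}]. *)
Definition shift_poly (h : nat) (S : {set 'I_h}) : {poly int} :=
  \prod_(i in S) ('X - (- (i.+1%:Z))%:P).

Lemma horner_shift_poly (R : comNzRingType) (h : nat) (S : {set 'I_h}) (x : R) :
  (map_poly intr (shift_poly S)).[x] = \prod_(i in S) (x + i.+1%:R).
Proof.
rewrite /shift_poly rmorph_prod horner_prod; apply: eq_bigr => i _.
by rewrite rmorphB /= map_polyX map_polyC hornerXsubC /= rmorphN opprK.
Qed.

Lemma horner_shift_polyZ (h : nat) (S : {set 'I_h}) (x : int) :
  (shift_poly S).[x] = \prod_(i in S) (x + i.+1%:R).
Proof.
rewrite /shift_poly horner_prod; apply: eq_bigr => i _.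
by rewrite hornerXsubC opprK natz.
Qed.

Lemma size_shift_poly (h : nat) (S : {set 'I_h}) : size (shift_poly S) = #|S|.+1.
Proof. by rewrite /shift_poly -big_enum size_prod_XsubC cardE. Qed.

(** Each factor [X + z] with [z <= h] multiplies the bound on the coefficients by [h.+1]. The lower
    bound 0 ensures that the difference of two such polynomials obeys the same bound. *)
Lemma coef_shift_poly (h : nat) (S : {set 'I_h}) (k : nat) :
  0 <= (shift_poly S)`_k <= (h.+1 ^ #|S|)%N%:Z.
Proof.
rewrite /shift_poly -big_enum cardE; move: (enum S) => s; elim: s k => [|i s IH] k.
  by rewrite big_nil coef1 expn0; case: k.
rewrite big_cons /=; move: (bigop _ _ _) IH => q IH.
rewrite mulrBl coefB coefXM coefCM mulNr opprK.
have /andP[l1 u1] := IH k; have /andP[l2 u2] := IH k.-1.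
have lei : i.+1%:Z <= h%:Z by rewrite lez_nat ltn_ord.
rewrite expnS mulSn PoszD PoszM.
have u3 : i.+1%:Z * q`_k <= h%:Z * (h.+1 ^ size s)%N%:Z by apply: ler_pM.
have l3 : 0 <= i.+1%:Z * q`_k by apply: mulr_ge0.
by case: eqP => _; apply/andP; split; rewrite ?add0r ?addr_ge0 // ?lerD // (le_trans u3) // lerDr.
Qed.

(** The minimal polynomial of [x] is scaled to an integral [f] which, by Gauss's lemma, divides [F]
    in [{poly int}]: the integers [f.[- z]] will have to divide [F.[- z]]. *)
Lemma int_min_poly (F : {poly int}) (x : algC) : F != 0 -> root (map_poly intr F) x ->
  exists f : {poly int}, [/\ (1 < size f)%N, exists r, F = f * r
    & forall G : {poly int}, root (map_poly intr G) x ->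
      forall y : algC, root (map_poly intr f) y -> root (map_poly intr G) y].
Proof.
move=> F0 Fx; have [m [mE mon] dvm] := minCpolyP x.
have intrE (G : {poly int}) : map_poly intr G = map_poly ratr (map_poly intr G) :> {poly algC}.
  by rewrite -map_poly_comp; apply: eq_map_poly => c /=; rewrite ratr_int.
have /dvdpP_rat_int [f [a a0 fE] [r rE]] : m %| map_poly intr F by rewrite -dvm -intrE.
have mf : map_poly ratr m = ratr a *: map_poly intr f :> {poly algC}.
  by rewrite fE map_polyZ /= -intrE.
exists f; split; last 1 first.
- move=> G Gx y fy; move: Gx; rewrite intrE dvm => /dvdpP[q ->].
  by rewrite rmorphM /= rootM mf rootZ ?fmorph_eq0 // fy orbT.
- have mx : root (map_poly ratr m) x by rewrite dvm.
  have fx : root (map_poly intr f) x by rewrite mf rootZ ?fmorph_eq0 // in mx.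
  have f0 : f != 0 by apply: contraNneq F0 => f0; rewrite rE f0 mul0r.
  have : map_poly intr f != 0 :> {poly algC}.
    by rewrite map_poly_eq0_id0 // intr_eq0 lead_coef_eq0.
  move/root_size_gt1 => /(_ x fx); rewrite size_map_poly_id0 //.
  by rewrite intr_eq0 lead_coef_eq0.
- by exists r.
Qed.

(* Up to sign, both sides are the product of [P_S] resp. [P_T] over the roots of [f],
   times a power of the leading coefficient of [f]. *)
Lemma norm_eq (h : nat) (S T : {set 'I_h}) (f : {poly int}) :
  #|S| = #|T| ->
  (forall y : algC, root (map_poly intr f) y ->
    (map_poly intr (shift_poly S)).[y] = (map_poly intr (shift_poly T)).[y]) ->
  \prod_(i in S) f.[- i.+1%:R] = \prod_(i in T) f.[- i.+1%:R].
Proof.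
move=> cST ST; apply: (@mulrIz algC 1); first exact: oner_neq0.
have [rs fE] := closed_field_poly_normal (map_poly intr f : {poly algC}).
set c := lead_coef _ in fE.
have rsP y : y \in rs -> root (map_poly intr f) y.
  by move=> yrs; rewrite fE rootE hornerZ (eqP (_ : root _ y)) ?mulr0 // root_prod_XsubC.
have normE (U : {set 'I_h}) : (\prod_(i in U) f.[- i.+1%:R])%:~R
   = c ^+ #|U| * \prod_(y <- rs) ((-1) ^+ #|U| * (map_poly intr (shift_poly U)).[y]) :> algC.
  rewrite rmorph_prod -prodr_const /=.
  under [X in _ = _ * X]eq_bigr => y _ do rewrite -prodr_const horner_shift_poly -big_split /=.
  rewrite exchange_big /= -big_split /=; apply: eq_bigr => i _.
  rewrite -horner_map /= fE hornerZ horner_prod; congr (_ * _).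
  apply: eq_bigr => y _; rewrite hornerXsubC rmorphN /= mulN1r opprD addrC.
  by rewrite rmorph_nat.
rewrite !normE cST; congr (_ * _); apply: eq_big_seq => y yrs; congr (_ * _).
by rewrite ST // rsP.
Qed.

Lemma leq_card_bigcup (I T : finType) (A : {set I}) (F : I -> {set T}) :
  (#|\bigcup_(i in A) F i| <= \sum_(i in A) #|F i|)%N.
Proof.
elim/big_ind2: _ => [|m X n Y Xm Yn|//]; first by rewrite cards0.
by rewrite (leq_trans (leq_card_setU _ _)) // leq_add.
Qed.

Lemma leq_card_fibers (T : finType) (U : eqType) (g : T -> U) (s : seq U) (c : nat) :
  (forall d, d \in s -> (#|[set i | g i == d]| <= c)%N) -> (#|[set i | g i \in s]| <= size s * c)%N.
Proof.
elim: s => [|d s IH] gc.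
  by rewrite (_ : [set _ | _] = set0) ?cards0 //; apply/setP => i; rewrite !inE.
have -> : [set i | g i \in d :: s] = [set i | g i == d] :|: [set i | g i \in s].
  by apply/setP => i; rewrite !inE.
rewrite (leq_trans (leq_card_setU _ _)) // mulSn leq_add ?gc ?mem_head //.
by apply: IH => d' d's; rewrite gc // inE d's orbT.
Qed.

Lemma horner_shift_poly_in (h : nat) (S : {set 'I_h}) (i : 'I_h) :
  i \in S -> (shift_poly S).[- i.+1%:R] = 0.
Proof. by move=> iS; rewrite horner_shift_polyZ (bigD1 i) //= addNr mul0r. Qed.

Lemma horner_shift_poly_notin (h : nat) (S : {set 'I_h}) (i : 'I_h) :
  i \notin S -> (0 < `|(shift_poly S).[- i.+1%:R]| <= h ^ #|S|)%N.
Proof.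
move=> iS; rewrite horner_shift_polyZ absz_gt0.
have -> : absz (\prod_(j in S) (- i.+1%:R + j.+1%:R))%R
        = (\prod_(j in S) absz (- i.+1%:R + j.+1%:R)%R)%N.
  by elim/big_rec2: _ => // j m x _ <-; rewrite abszM.
apply/andP; split.
  apply/prodf_neq0 => j jS; rewrite addrC subr_eq0 eqr_nat eqSS.
  by apply: contraNneq iS => ji; rewrite -(val_inj ji).
rewrite -prod_nat_const; apply: leq_prod => j _.
rewrite !natz; have := ltn_ord i; have := ltn_ord j; lia.
Qed.

(** The factor 2 accounts for the two signs of a value of modulus [d]. *)
Lemma card_abs_fiber (h : nat) (f : {poly int}) (d : nat) : (1 < size f)%N ->
  (#|[set i : 'I_h | `|f.[- i.+1%:R]|%N == d]| <= 2 * (size f).-1)%N.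
Proof.
move=> sf.
have fiber (c : int) : (#|[set i : 'I_h | f.[- i.+1%:R] == c]| <= (size f).-1)%N.
  have sfc : size (f - c%:P) = size f.
    by rewrite size_polyDl // size_polyN (leq_ltn_trans (size_polyC_leq1 _)).
  have nz : f - c%:P != 0 by rewrite -size_poly_gt0 sfc ltnW.
  rewrite -ltnS prednK ?(ltnW sf) // -sfc cardE.
  rewrite -(size_map (fun i : 'I_h => - i.+1%:R : int)).
  apply: max_poly_roots => //.
    apply/allP=> x /mapP[i]; rewrite mem_enum inE => /eqP fi ->.
    by rewrite rootE hornerD hornerN hornerC fi subrr.
  rewrite map_inj_uniq ?enum_uniq // => i j /oppr_inj /eqP.
  by rewrite eqr_nat eqSS => /eqP /val_inj.
have sub : [set i : 'I_h | `|f.[- i.+1%:R]|%N == d]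
    \subset [set i : 'I_h | f.[- i.+1%:R] == d%:Z] :|: [set i : 'I_h | f.[- i.+1%:R] == - d%:Z].
  by apply/subsetP => i; rewrite !inE; lia.
apply: leq_trans (subset_leq_card sub) _.
by rewrite (leq_trans (leq_card_setU _ _)) // mul2n -addnn leq_add.
Qed.

(** * Families of subsets with a common value of [P_S] *)

(** In the bound, 1 counts [S1], [n] bounds the number of complex roots of [F S2], [D] the number of
    divisors of [N], and [2 * n] the number of [z] where one [f] has a given modulus. The common
    size [m] may lie below [n] because the induction of [class_bound] lowers it. *)
Lemma disjoint_family_bound (p h n m D : nat) (b : 'F_p) (Fam : {set {set 'I_h}}) :
  prime p -> (0 < m <= n)%N ->
  (forall S, S \in Fam -> #|S| = m) ->
  {in Fam &, forall S T,
     (map_poly intr (shift_poly S)).[b] = (map_poly intr (shift_poly T)).[b]} ->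
  {in Fam &, forall S T : {set 'I_h}, S != T -> [disjoint S & T]} ->
  ((2 * n)`! * (h.+1 ^ n) ^ (2 * n) < p)%N ->
  (forall N, (0 < N <= h ^ (n * n))%N -> (size (divisors N) <= D)%N) ->
  (#|Fam| <= 1 + n * (D * (2 * n)))%N.
Proof.
move=> p_pr /andP[m0 mn] cardF valF disF ltp HD.
have [|/card_gt1P [S1 [S2 [S1F S2F S12]]]] := leqP #|Fam| 1; first by move/leq_trans->.
rewrite eq_sym in S12.
pose F (S : {set 'I_h}) : {poly int} := shift_poly S - shift_poly S1.
have disS S i : S \in Fam -> S != S1 -> i \in S -> i \notin S1.
  by move=> SF SS1 iS; have /disjointFr -> := disF _ _ SF S1F SS1.
have FS_in S i : S \in Fam -> S != S1 -> i \in S -> (0 < `|(F S).[- i.+1%:R]|)%N.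
  move=> SF SS1 iS; rewrite hornerD hornerN horner_shift_poly_in // sub0r abszN.
  by have /andP[] := horner_shift_poly_notin (disS _ _ SF SS1 iS).
have nonempty S : S \in Fam -> exists i, i \in S.
  by move=> SF; apply/set0Pn; rewrite -card_gt0 cardF.
(* At [- z] with [z] in [S], [F S] takes the value [- P_(S1)(- z)], which is nonzero by
   disjointness. *)
have F0 S : S \in Fam -> S != S1 -> F S != 0.
  move=> SF SS1; have [i iS] := nonempty _ SF; have := FS_in _ _ SF SS1 iS.
  by apply: contraTneq => ->; rewrite horner0.
have sF S : S \in Fam -> (size (F S) <= n.+1)%N.
  move=> SF; rewrite (leq_trans (size_polyD _ _)) // size_polyN !size_shift_poly.
  by rewrite !cardF // maxnn ltnS.
have h0 : (0 < h)%N by have [i _] := nonempty _ S1F; apply: leq_ltn_trans (ltn_ord i).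
have cF S k : S \in Fam -> `|(F S)`_k| <= (h.+1 ^ n)%N%:Z.
  move=> SF; rewrite coefB.
  have := coef_shift_poly S k; have := coef_shift_poly S1 k; rewrite !cardF //.
  have : (h.+1 ^ m <= h.+1 ^ n)%N by rewrite leq_exp2l.
  move: (_ ^ m)%N (_ ^ n)%N (shift_poly S)`_k (shift_poly S1)`_k => A B u v.
  lia.
have rF S : S \in Fam -> root (map_poly intr (F S)) b.
  by move=> SF; rewrite rootE rmorphB hornerD hornerN (valF S S1) // subrr.
have F20 := F0 _ S2F S12.
have [rs rsE] := closed_field_poly_normal (map_poly intr (F S2) : {poly algC}).
have mF20 : map_poly intr (F S2) != 0 :> {poly algC}.
  by rewrite map_poly_eq0_id0 // intr_eq0 lead_coef_eq0.
have lc0 : lead_coef (map_poly intr (F S2) : {poly algC}) != 0 by rewrite lead_coef_eq0.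
have memrs x : (x \in rs) = root (map_poly intr (F S2)) x.
  by rewrite rsE rootZ // root_prod_XsubC.
have srs : (size rs <= n)%N.
  rewrite -ltnS (leq_trans _ (sF _ S2F)) //.
  have := congr1 (fun q : {poly algC} => size q) rsE.
  rewrite size_scale // size_prod_XsubC size_map_poly_id0 => [->//|].
  by rewrite intr_eq0 lead_coef_eq0.
have fex (k : 'I_(size rs)) : exists f : {poly int},
    [/\ (1 < size f)%N, exists r, F S2 = f * r
    & forall G : {poly int}, root (map_poly intr G) rs`_k ->
      forall y : algC, root (map_poly intr f) y -> root (map_poly intr G) y].
  by apply: int_min_poly; rewrite // -memrs mem_nth.
have [f fP] := fin_all_exists fex.
(* The integer independent of [S]. On the negatives of elements of [S1], [F S2] agrees with
   [P_(S2)], so [N] is nonzero and at most [h ^ (n * n)]. *)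
pose N := absz (\prod_(i in S1) (F S2).[- i.+1%:R])%R.
have NE : N = (\prod_(i in S1) absz (F S2).[- i.+1%:R]%R)%N.
  by rewrite /N; elim/big_rec2: _ => // j a x _ <-; rewrite abszM.
have F2S1 i : i \in S1 -> (0 < `|(F S2).[- i.+1%:R]| <= h ^ m)%N.
  move=> iS; rewrite hornerD hornerN [X in _ - X]horner_shift_poly_in // subr0.
  have iS2 : i \notin S2 by have /disjointFl -> := disF _ _ S2F S1F S12.
  by have := horner_shift_poly_notin iS2; rewrite cardF.
have N0 : (0 < N)%N by rewrite NE prodn_cond_gt0 // => i /F2S1 /andP[].
have Nle : (N <= h ^ (n * n))%N.
  rewrite NE; apply: (@leq_trans (\prod_(i in S1) h ^ m)).
    by apply: leq_prod => i /F2S1 /andP[].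
  by rewrite prod_nat_const cardF // -expnM leq_pexp2l // leq_mul.
have DN : (size (divisors N) <= D)%N by apply: HD; rewrite N0.
pose Z := \bigcup_(k in [set: 'I_(size rs)])
  [set i : 'I_h | `|(f k).[- i.+1%:R]|%N \in divisors N].
have cardZ : (#|Z| <= n * (D * (2 * n)))%N.
  apply: leq_trans (leq_card_bigcup _ _) _.
  apply: (@leq_trans (\sum_(k in [set: 'I_(size rs)]) D * (2 * n))); last first.
    by rewrite sum_nat_const cardsT card_ord leq_mul2r srs orbT.
  apply: leq_sum => k _; have [sf [r rE] _] := fP k.
  apply: leq_trans (leq_card_fibers (fun d _ => card_abs_fiber h d sf)) _.
  rewrite leq_mul // leq_mul2l /=; rewrite -ltnS prednK ?(ltnW sf) //.
  apply: leq_trans (sF _ S2F).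
  have r0 : r != 0 by apply: contraNneq F20 => r0; rewrite rE r0 mulr0.
  have f0 : f k != 0 by rewrite -size_poly_gt0 ltnW.
  rewrite rE size_mul // -subn1 -addnBA ?size_poly_gt0 // leq_addr //.
(* The argument puts every element of [S] into [Z]; one per set is enough, since disjointness makes
   the chosen elements distinct. *)
have meetZ S : S \in Fam :\ S1 -> S :&: Z != set0.
  rewrite !inE => /andP[SS1 SF].
  have [x xF2 xF] := common_root p_pr (leq_trans m0 mn) (expn_gt0 _ _ : (0 < h.+1 ^ n)%N)
    (sF _ S2F) (sF _ SF) F20 (F0 _ SF SS1) (cF S2 ^~ S2F) (cF S ^~ SF) (rF _ S2F) (rF _ SF) ltp.
  have xrs : x \in rs by rewrite memrs.
  have kP : (index x rs < size rs)%N by rewrite index_mem.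
  pose k := Ordinal kP; have [sf [r rE] yP] := fP k.
  have kx : rs`_k = x by rewrite nth_index.
  have [i iS] := nonempty _ SF.
  apply/set0Pn; exists i; rewrite inE iS; apply/bigcupP; exists k; rewrite ?inE //.
  rewrite -dvdn_divisors // -dvdzE.
  have neq : \prod_(i in S) (f k).[- i.+1%:R] = \prod_(i in S1) (f k).[- i.+1%:R].
    apply: norm_eq; first by rewrite !cardF.
    move=> y yf; have := yP (F S); rewrite kx => /(_ xF _ yf).
    by rewrite rootE rmorphB hornerD hornerN subr_eq0 => /eqP.
  have : ((f k).[- i.+1%:R] %| \prod_(i in S) (f k).[- i.+1%:R])%Z.
    by rewrite (bigD1 i) //= dvdz_mulr.
  rewrite neq => /dvdz_trans; apply.
  under [X in (_ %| X)%Z]eq_bigr => j _ do rewrite rE hornerM.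
  by rewrite big_split dvdz_mulr.
rewrite (cardsD1 S1) S1F leq_add2l; apply: leq_trans cardZ.
pose z S := [pick i in S :&: Z].
have zP S : S \in Fam :\ S1 -> exists2 i, z S = Some i & i \in S :&: Z.
  move=> /meetZ /set0Pn [i0 iSZ]; rewrite /z; case: pickP => [i iZ|/(_ i0)]; first by exists i.
  by rewrite iSZ.
have zinj : {in Fam :\ S1 &, injective z}.
  move=> S T SF TF; have [i -> ] := zP S SF; have [j ->] := zP T TF.
  rewrite !inE => /andP[jT _] /andP[iS _] [ij]; apply/eqP; apply/negPn/negP => ST.
  move: SF TF; rewrite !inE => /andP[_ SF] /andP[_ TF].
  by have := disF _ _ SF TF ST; move/disjointFr => /(_ i iS); rewrite ij jT.
rewrite -(card_in_imset zinj) -(card_imset Z (@Some_inj _)); apply: subset_leq_card.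
apply/subsetP => o /imsetP[S /zP [i -> ]]; rewrite inE => /andP[_ iZ] ->.
exact: imset_f.
Qed.

(* A maximal disjoint subfamily has at most [R] members, so at most [R * n] points
   meet every member; fix one of them, remove it, and induct. *)
Lemma class_bound (p h n R : nat) (b : 'F_p) :
  (forall i : 'I_h, b + i.+1%:R != 0) ->
  (forall m (Fam : {set {set 'I_h}}), (0 < m <= n)%N ->
     (forall S, S \in Fam -> #|S| = m) ->
     {in Fam &, forall S T,
       (map_poly intr (shift_poly S)).[b] = (map_poly intr (shift_poly T)).[b]} ->
     {in Fam &, forall S T : {set 'I_h}, S != T -> [disjoint S & T]} -> (#|Fam| <= R)%N) ->
  forall m (Fam : {set {set 'I_h}}), (m <= n)%N -> (forall S, S \in Fam -> #|S| = m) ->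
    {in Fam &, forall S T,
      (map_poly intr (shift_poly S)).[b] = (map_poly intr (shift_poly T)).[b]} ->
    (#|Fam| <= (R * n) ^ m)%N.
Proof.
move=> b0 HR; elim=> [|m IH] Fam mn cF vF.
  rewrite expn0 -(cards1 (set0 : {set 'I_h})); apply: subset_leq_card.
  by apply/subsetP=> S /cF /eqP; rewrite cards_eq0 inE.
pose good (A : {set {set 'I_h}}) := (A \subset Fam) && trivIset A.
have good0 : good set0 by rewrite /good sub0set; apply/trivIsetP => B C; rewrite inE.
have [A /maxsetP[/andP[AF /trivIsetP trA] maxA] _] := maxset_exists good0.
have AR : (#|A| <= R)%N.
  apply: (HR m.+1) => //; first by move=> S /(subsetP AF) /cF.
  by move=> S T /(subsetP AF) SF /(subsetP AF) TF; apply: vF.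
pose U := cover A.
have cardU : (#|U| <= R * n)%N.
  apply: leq_trans (leq_card_bigcup _ _) _.
  apply: (@leq_trans (\sum_(B in A) n)); last by rewrite sum_nat_const leq_mul2r AR orbT.
  by apply: leq_sum => B /(subsetP AF) /cF ->.
have meetU S : S \in Fam -> exists2 u, u \in U & u \in S.
  move=> SF; have [/existsP[u /andP[uU uS]]|noU] := boolP [exists u, (u \in U) && (u \in S)].
    by exists u.
  have dis B : B \in A -> [disjoint S & B].
    move=> BA; rewrite disjoint_subset; apply/subsetP => u uS; rewrite inE.
    apply: contra noU => uB; apply/existsP; exists u; rewrite uS andbT.
    by apply/bigcupP; exists B.
  (* A set disjoint from all members of [A] belongs to [A] by maximality, hence is disjoint from
     itself, hence empty. *)
  have : S |: A = A.
    apply: maxA; last exact: subsetUr.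
    rewrite /good subUset sub1set SF AF /=; apply/trivIsetP => B C.
    rewrite !in_setU1 => /orP[/eqP->|BA] /orP[/eqP->|CA]; rewrite ?eqxx // => BC.
    - exact: dis.
    - by rewrite disjoint_sym dis.
    - exact: trA.
  move/setP/(_ S); rewrite !inE eqxx /= => /esym SA.
  have : S != set0 by rewrite -card_gt0 cF.
  by have := dis _ SA; rewrite -setI_eq0 setIid => ->.
have sub : Fam \subset \bigcup_(u in U) [set S in Fam | u \in S].
  apply/subsetP => S SF; have [u uU uS] := meetU _ SF.
  by apply/bigcupP; exists u; rewrite // inE SF.
apply: leq_trans (subset_leq_card sub) _.
apply: leq_trans (leq_card_bigcup _ _) _.
apply: (@leq_trans (\sum_(u in U) (R * n) ^ m)); last first.
  by rewrite sum_nat_const expnS leq_mul2r cardU orbT.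
apply: leq_sum => u _.
have inj : {in [set S in Fam | u \in S] &, injective (fun S : {set 'I_h} => S :\ u)}.
  move=> S T; rewrite !inE => /andP[_ uS] /andP[_ uT] ST.
  by rewrite -(setD1K uS) ST setD1K.
rewrite -(card_in_imset inj); apply: IH; first exact: ltnW.
  move=> S /imsetP[T]; rewrite inE => /andP[/cF cT uT] ->.
  by move: cT; rewrite (cardsD1 u) uT => -[].
move=> S T /imsetP[S']; rewrite inE => /andP[S'F uS'] -> /imsetP[T'].
(* Removing [u] divides both values by the nonzero [b + u.+1], so the smaller sets still share one
   value. *)
rewrite inE => /andP[T'F uT'] ->; apply: (mulfI (b0 u)).
have := vF _ _ S'F T'F; rewrite !horner_shift_poly (big_setD1 u uS') /=.
by rewrite [X in _ = X -> _](big_setD1 u uT').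
Qed.

(** As [1 + a z = a (a^-1 + z)], each [a ^ n P_S(a^-1)] is an [e]-th root of unity. This leaves at
    most [e] classes of [n]-subsets, each limited by [class_bound]. *)
Lemma binomial_le_translates (p e h n R : nat) (a : 'F_p) :
  prime p -> (0 < e)%N -> a != 0 ->
  (forall i : 'I_h, (1 + a * i.+1%:R) ^+ e = 1) ->
  (forall m (Fam : {set {set 'I_h}}), (0 < m <= n)%N ->
     (forall S, S \in Fam -> #|S| = m) ->
     {in Fam &, forall S T,
       (map_poly intr (shift_poly S)).[a^-1] = (map_poly intr (shift_poly T)).[a^-1]} ->
     {in Fam &, forall S T : {set 'I_h}, S != T -> [disjoint S & T]} -> (#|Fam| <= R)%N) ->
  ('C(h, n) <= e * (R * n) ^ n)%N.
Proof.
move=> p_pr e0 a0 ae HR.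
have abE (i : 'I_h) : 1 + a * i.+1%:R = a * (a^-1 + i.+1%:R).
  by rewrite mulrDr divff.
have b0 (i : 'I_h) : a^-1 + i.+1%:R != 0.
  apply/eqP => bi; have /eqP := ae i.
  by rewrite abE bi mulr0 expr0n gtn_eqF // eq_sym oner_eq0.
pose v (S : {set 'I_h}) := (map_poly intr (shift_poly S)).[a^-1] : 'F_p.
(* [None] keeps subsets of other sizes out of the fibers considered. *)
pose g (S : {set 'I_h}) := if #|S| == n then Some (v S) else None.
pose s := [seq Some x | x <- enum [set x : 'F_p | (a ^+ n * x) ^+ e == 1]].
have gs (S : {set 'I_h}) : #|S| = n -> g S \in s.
  move=> Sn; rewrite /g Sn eqxx; apply: map_f; rewrite mem_enum inE /v horner_shift_poly.
  rewrite -Sn -prodr_const -big_split -prodrXl big1 //= => i _.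
  by rewrite -abE ae.
have ssz : (size s <= e)%N.
  rewrite size_map -(size_map (fun x => a ^+ n * x)).
  apply: max_unity_roots => //.
    apply/allP => y /mapP[x]; rewrite mem_enum inE => xe ->.
    by apply/unity_rootP/eqP.
  rewrite map_inj_uniq ?enum_uniq //; apply: mulfI; exact: expf_neq0.
rewrite -[h in 'C(h, _)]card_ord -card_draws.
apply: (@leq_trans #|[set S : {set 'I_h} | g S \in s]|).
  by apply: subset_leq_card; apply/subsetP => S; rewrite !inE => /eqP /gs.
apply: (@leq_trans (size s * (R * n) ^ n)); last by rewrite leq_mul2r ssz orbT.
apply: leq_card_fibers => _ /mapP[x _ ->].
apply: (class_bound b0 HR) => //.
  by move=> S; rewrite inE /g; case: ifP => // /eqP.
move=> S T; rewrite !inE /g; case: ifP => // _ /eqP[Sx]; case: ifP => // _ /eqP[Tx].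
by rewrite -/(v S) -/(v T) Sx Tx.
Qed.

(** * Small [z] for which [1 + a z] is not an [e]-th root of unity *)

Lemma Fp_nat_inj (p i j : nat) : prime p -> (i < p)%N -> (j < p)%N ->
  i%:R = j%:R :> 'F_p -> i = j.
Proof.
move=> p_pr ip jp /(congr1 val).
by rewrite /= !val_Fp_nat // !modn_small.
Qed.

(** Otherwise [1, 1 + a, ..., 1 + a e] would be [e.+1] roots of [X ^ e - 1], distinct because
    [e < p]. *)
Lemma exists_translate_trivial (p e : nat) (a : 'F_p) : prime p -> (0 < e <= p.-1)%N -> a != 0 ->
  exists2 z, (0 < z <= e)%N & (1 + a * z%:R) ^+ e != 1.
Proof.
move=> p_pr /andP[e0 ep] a0.
have p0 := prime_gt0 p_pr.
suff /existsP[i iP] : [exists i : 'I_e, (1 + a * i.+1%:R) ^+ e != 1] by exists i.+1; rewrite ?ltn_ord.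
apply: contraT => /existsPn all1; exfalso.
have : (e.+1 <= e)%N; last by rewrite ltnn.
rewrite -[X in (X <= _)%N](size_iota 0) -(size_map (fun i : nat => 1 + a * i%:R)).
apply: max_unity_roots => //.
  apply/allP=> x /mapP[[|i] iP ->]; apply/unity_rootP; first by rewrite mulr0 addr0 expr1n.
  rewrite mem_iota /= add0n ltnS in iP.
  by have := all1 (Ordinal iP) => /=; rewrite negbK => /eqP.
rewrite map_inj_in_uniq ?iota_uniq // => i j.
rewrite !mem_iota !add0n => /andP[_ ie] /andP[_ je] /addrI /(mulfI a0).
by apply: Fp_nat_inj => //; lia.
Qed.

(** Every factor of the falling factorial is at least [h / 2]. *)
Lemma expn_le_ffact (h k : nat) : (2 * k <= h)%N -> (h ^ k <= 2 ^ k * h ^_ k)%N.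
Proof.
elim: k => [|k IH] kh //; rewrite expnSr ffactnSr expnSr.
by rewrite mulnACA leq_mul ?IH //; lia.
Qed.

Lemma exists_translate_small (m : nat) : (0 < m)%N -> exists B,
  forall (p e h : nat) (a : 'F_p), prime p -> (0 < e)%N -> (e ^ (16 * m) <= p)%N ->
    (e < h ^ m <= 2 ^ m.+1 * e)%N -> (B <= h)%N -> a != 0 ->
  exists2 z, (0 < z <= minn h p.-1)%N & (1 + a * z%:R) ^+ e != 1.
Proof.
move=> m0; have [C HC] := divisor_bound (16 * m * m).
pose n := (2 * m)%N.
(* [A] gathers the constants of [h ^ m <= A * D ^ n], and [A3] those of the resultant bound
   [A3 * e ^ (8 * m)]. The threshold makes [h] exceed [A ^ (8 * m) * C] and, through
   [h <= 2 ^ m.+1 * e], makes [e] exceed [A3]. *)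
pose A := (2 ^ n * n`! * (3 * n ^ 3) ^ n)%N.
pose A3 := ((4 * m)`! * 2 ^ (8 * m * m) * (2 ^ m.+1) ^ (8 * m))%N.
exists (4 * m + (A ^ (8 * m) * C) + 2 ^ m.+1 * A3).+1 => p e h a p_pr e0 ep /andP[eh he] Bh a0.
have n0 : (0 < n)%N by rewrite muln_gt0.
have h0 : (0 < h)%N by lia.
have hm : (h <= h ^ m)%N by rewrite -[X in (X <= _)%N]expn1 leq_pexp2l.
have A3e : (A3 < e)%N.
  have : (2 ^ m.+1 * A3 < 2 ^ m.+1 * e)%N by lia.
  by rewrite ltn_mul2l => /andP[].
have e_le (i : nat) : (0 < i)%N -> (e <= e ^ i)%N.
  by move=> i0; rewrite -[X in (X <= _)%N]expn1 leq_pexp2l.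
have ltp : ((2 * n)`! * (h.+1 ^ n) ^ (2 * n) < p)%N.
  apply: leq_trans ep.
  apply: (@leq_ltn_trans (A3 * e ^ (8 * m))); last first.
    rewrite (_ : 16 * m = 8 * m + 8 * m)%N; last by lia.
    by rewrite expnD ltn_mul2r expn_gt0 e0 (leq_trans A3e) // e_le // muln_gt0.
  rewrite (_ : 2 * n = 4 * m)%N; last by rewrite /n; lia.
  rewrite /A3 -!mulnA leq_mul2l; apply/orP; right.
  apply: (@leq_trans ((2 * h) ^ (8 * (m * m)))).
    rewrite -expnM (_ : n * (4 * m) = 8 * (m * m))%N; last by rewrite /n; lia.
    by rewrite leq_exp2r; lia.
  rewrite expnMn leq_mul2l; apply/orP; right.
  rewrite -expnMn (_ : 8 * (m * m) = m * (8 * m))%N; last by lia.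
  by rewrite expnM leq_exp2r // muln_gt0.
have hp : (h <= p.-1)%N.
  have A3big : (2 ^ m.+1 <= A3)%N.
    rewrite /A3; apply: leq_trans (leq_pmull _ _); last by rewrite muln_gt0 fact_gt0 expn_gt0.
    by rewrite -expnM leq_exp2l // leq_pmulr // muln_gt0.
  have : (h < e ^ (16 * m))%N.
    apply: leq_ltn_trans hm _; apply: leq_ltn_trans he _.
    apply: (@leq_trans (e ^ 2)); last by rewrite leq_pexp2l //; lia.
    by rewrite -mulnn ltn_mul2r e0 (leq_ltn_trans A3big).
  have := prime_gt0 p_pr; lia.
rewrite (minn_idPl hp).
suff /existsP[i iP] : [exists i : 'I_h, (1 + a * i.+1%:R) ^+ e != 1] by exists i.+1; rewrite ?ltn_ord.
apply: contraT => /existsPn all1; exfalso.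
pose D := (\max_(N < (h ^ (n * n)).+1 | 0 < N) size (divisors N))%N.
have HD N : (0 < N <= h ^ (n * n))%N -> (size (divisors N) <= D)%N.
  case/andP=> N0 Nle; rewrite -ltnS in Nle.
  exact: (leq_bigmax_cond (Ordinal Nle)).
have D0 : (0 < D)%N.
  by apply: leq_trans (HD 1%N _); rewrite // expn_gt0 h0.
(* Up to a constant, [D <= h ^ (1/4)]: the exponent of the divisor bound is four times
   [n * n = 4 * m * m]. *)
have DC : (D ^ (16 * m * m) <= C * h ^ (4 * m * m))%N.
  rewrite /D; elim/big_ind: _ => [|x y xP yP|N N0].
  - by rewrite exp0n // !muln_gt0 m0.
  - by case: (leqP x y).
  - apply: leq_trans (HC _ N0) _; rewrite leq_mul2l (_ : 4 * m * m = n * n)%N; last by rewrite /n; lia.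
    by rewrite -ltnS ltn_ord orbT.
have bin : ('C(h, n) <= e * ((1 + n * (D * (2 * n))) * n) ^ n)%N.
  apply: (binomial_le_translates p_pr e0 a0).
    by move=> i; apply/eqP; have := all1 i; rewrite negbK.
  move=> m' Fam m'n cF vF dF.
  exact: (disjoint_family_bound p_pr m'n cF vF dF ltp HD).
have h2n : (2 * n <= h)%N by rewrite /n; lia.
(* Of the two factors [h ^ m] in [h ^ n], one cancels against the bound [e < h ^ m]. *)
have hmD : (h ^ m <= A * D ^ n)%N.
  have hm0 : (0 < h ^ m)%N by rewrite expn_gt0 h0.
  rewrite -(leq_pmul2r hm0) -expnD addnn -mul2n -/n.
  apply: leq_trans (expn_le_ffact h2n) _.
  rewrite -bin_ffact.
  apply: (@leq_trans (2 ^ n * (h ^ m * (3 * n ^ 3 * D) ^ n * n`!))); last first.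
    by rewrite /A [((_ * D) ^ n)%N]expnMn; move: (_ ^ n)%N (_ ^ n)%N (_ ^ n)%N (_ ^ m)%N n`! => *; lia.
  rewrite leq_mul2l leq_mul2r; apply/orP; right; apply/orP; right.
  apply: leq_trans bin _; apply: leq_mul; first exact: ltnW.
  rewrite leq_exp2r //.
  have -> : (n ^ 3 = n * n * n)%N by rewrite !expnS expn0 muln1 !mulnA.
  have -> : (3 * (n * n * n) * D = (D * (2 * n) * n + n * n * D) * n)%N by lia.
  rewrite leq_mul2r; apply/orP; right.
  have : (0 < n * n * D)%N by rewrite (muln_gt0 (n * n)) (muln_gt0 n) n0 D0.
  lia.
(* The power [8 * m] turns [D ^ n] into [D ^ (16 * m * m)]; cancelling leaves
   [h ^ (4 * m * m) <= A ^ (8 * m) * C], against the choice of the threshold. *)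
have : (h ^ (4 * m * m) * h ^ (4 * m * m) <= A ^ (8 * m) * C * h ^ (4 * m * m))%N.
  rewrite -expnD (_ : 4 * m * m + 4 * m * m = m * (8 * m))%N; last by lia.
  rewrite expnM.
  apply: (@leq_trans ((A * D ^ n) ^ (8 * m))); first by rewrite leq_exp2r // muln_gt0.
  rewrite expnMn -expnM -mulnA leq_mul2l; apply/orP; right.
  by rewrite (_ : n * (8 * m) = 16 * m * m)%N //; rewrite /n; lia.
have h4 : (0 < h ^ (4 * m * m))%N by rewrite expn_gt0 h0.
rewrite leq_pmul2r // leqNgt => /negP; apply.
apply: (@leq_trans h); first by lia.
by rewrite -[X in (X <= _)%N]expn1 leq_pexp2l // !muln_gt0 m0.
Qed.

(* [K] absorbs the bounded values of [h], for which [e <= K * h] and counting roots of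
   [X ^ e - 1] suffices. *)
Lemma exists_translate (m : nat) : (0 < m)%N -> exists2 K, (0 < K)%N &
  forall (p e h : nat) (a : 'F_p), prime p -> (0 < e <= p.-1)%N -> (m = 1)%N \/ (e ^ (16 * m) <= p)%N ->
    (e < h ^ m <= 2 ^ m.+1 * e)%N -> a != 0 ->
  exists2 z, (0 < z <= minn (K * h) p.-1)%N & (1 + a * z%:R) ^+ e != 1.
Proof.
move=> m0; have [B HB] := exists_translate_small m0.
exists (B ^ m).+1 => // p e h a p_pr /andP[e0 ep] em /andP[eh he] a0.
have h0 : (0 < h)%N by case: (posnP h) eh => // ->; rewrite exp0n // ltn0.
have triv : (e <= (B ^ m).+1 * h)%N ->
    exists2 z, (0 < z <= minn ((B ^ m).+1 * h) p.-1)%N & (1 + a * z%:R) ^+ e != 1.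
  have e0p : (0 < e <= p.-1)%N by rewrite e0.
  have [z /andP[z0 ze] za] := exists_translate_trivial p_pr e0p a0.
  move=> eK; exists z => //; rewrite z0 leq_min; lia.
have [Bh|hB] := leqP B h; last first.
  apply: triv; apply: leq_trans (leq_pmulr _ h0); apply: ltnW; apply: leq_trans eh _.
  by rewrite ltnW // ltnS leq_exp2r // ltnW.
(* With [m = 1] the window for [h] itself gives [e < h], so root counting settles this case. *)
case: em => [m1|em].
  apply: triv; rewrite m1 !expn1 in eh *; apply: leq_trans (ltnW eh) _.
  exact: leq_pmull.
have eh' : (e < h ^ m <= 2 ^ m.+1 * e)%N by rewrite eh.
have [z /andP[z0 zh] za] := HB p e h a p_pr e0 em eh' Bh a0.
exists z => //; rewrite z0 (leq_trans zh) // leq_min geq_minr andbT.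
by rewrite (leq_trans (geq_minl _ _)) // leq_pmull.
Qed.

End Translates.

(** * Structured oracle machines *)

(* A transition always writes, so branching may turn an absent cell into an explicit blank. *)
Definition touch (tp : tape) : tape := write (read tp) tp.

(** Loops run until the head reads a blank, blanks being the delimiters of stacks. *)
Inductive tm :=
  | TDo of (option bool -> option bool * move)
  | TQry
  | TSeq of tm & tm
  | TSw of (option bool -> tm)
  | TWhile of (bool -> tm).

Section Semantics.
Variables (O : nat -> nat) (ok : pred nat).

(* The last argument is only an upper bound on the number of steps. *)
Inductive ev : tm -> tape -> tape -> nat -> Prop :=
  | EvDo g tp n : 0 < n ->
      ev (TDo g) tp (mv (g (read tp)).2 (write (g (read tp)).1 tp)) n
  | EvQry tp n : ok (query_val tp) -> 0 < n -> ev TQry tp (answer O tp) n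
  | EvSeq a b tp tp1 tp2 n1 n2 n : ev a tp tp1 n1 -> ev b tp1 tp2 n2 -> n1 + n2 <= n ->
      ev (TSeq a b) tp tp2 n
  | EvSw f tp tp1 n1 n : ev (f (read tp)) (touch tp) tp1 n1 -> n1 < n -> ev (TSw f) tp tp1 n
  | EvWhileEnd f tp n : read tp = None -> 0 < n -> ev (TWhile f) tp (touch tp) n
  | EvWhileStep f b tp tp1 tp2 n1 n2 n : read tp = Some b -> ev (f b) (touch tp) tp1 n1 ->
      ev (TWhile f) tp1 tp2 n2 -> n1 + n2 < n -> ev (TWhile f) tp tp2 n.

(** * Compilation to a flat program *)

Inductive instr :=
  | IBr of (option bool -> option bool * move * nat)
  | IQry of nat
  | IHalt of bool.

Fixpoint code_size (c : tm) : nat :=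
  match c with
  | TDo _ | TQry => 1
  | TSeq a b => code_size a + code_size b
  | TSw f => (code_size (f None) + code_size (f (Some false)) + code_size (f (Some true))).+1
  | TWhile f => (code_size (f false) + code_size (f true)).+1
  end.

(** The code occupies the addresses from [a] on and leaves by a jump to [nxt]; a loop body exits to
    the address of its loop. *)
Fixpoint compile (c : tm) (a nxt : nat) : seq instr :=
  match c with
  | TDo g => [:: IBr (fun x => (g x, nxt))]
  | TQry => [:: IQry nxt]
  | TSeq c1 c2 => compile c1 a (a + code_size c1) ++ compile c2 (a + code_size c1) nxt
  | TSw f =>
      let a0 := a.+1 + code_size (f None) in
      let a1 := a0 + code_size (f (Some false)) in
      IBr (fun x => (x, Stay, match x with None => a.+1 | Some false => a0 | Some true => a1 end))
      :: compile (f None) a.+1 nxt ++ compile (f (Some false)) a0 nxt ++ compile (f (Some true)) a1 nxt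
  | TWhile f =>
      let a1 := a.+1 + code_size (f false) in
      IBr (fun x => (x, Stay, match x with None => nxt | Some false => a.+1 | Some true => a1 end))
      :: compile (f false) a.+1 a ++ compile (f true) a1 a
  end.

Lemma size_compile c a nxt : size (compile c a nxt) = code_size c.
Proof.
elim: c a nxt => [g||c1 IH1 c2 IH2|f IH|f IH] a nxt //=; rewrite !size_cat ?IH1 ?IH2 ?IH //.
by rewrite addnA.
Qed.

(** The state [size P] lies beyond the program and rejects by the default of [nth]; it also keeps
    the state type nonempty. *)
Definition machine (P : seq instr) : OTM :=
  {| state := 'I_(size P).+1; start := ord0;
     delta := fun q x => match nth (IHalt false) P q with
       | IBr g => Step (inord (g x).2) (g x).1.1 (g x).1.2
       | IQry n => Query (inord n)
       | IHalt true => Accept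
       | IHalt false => Reject
       end |}.

Section Compile.
Variable P : seq instr.
Notation M := (machine P).

(** [exec] has a result only for halting runs, so a partial run is expressed by continuations: a
    halting run from [pc'] extends backwards to one from [pc], all queries remaining [ok]. *)
Definition reach (pc pc' : nat) (tp tp' : tape) (k : nat) : Prop :=
  forall fuel b qs, all ok qs -> @exec M O fuel (inord pc' : 'I_(size P).+1) tp' = Some (b, qs) ->
  exists2 qs', all ok qs' & @exec M O (k + fuel) (inord pc : 'I_(size P).+1) tp = Some (b, qs').

Lemma reach_trans pc1 pc2 pc3 tp1 tp2 tp3 k1 k2 :
  reach pc1 pc2 tp1 tp2 k1 -> reach pc2 pc3 tp2 tp3 k2 -> reach pc1 pc3 tp1 tp3 (k1 + k2).
Proof.
move=> r1 r2 fuel b qs qok ex; have [qs2 q2ok ex2] := r2 _ _ _ qok ex.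
by have [qs1 q1ok ex1] := r1 _ _ _ q2ok ex2; exists qs1; rewrite // -addnA.
Qed.

Lemma reach_br pc g tp : pc < size P -> nth (IHalt false) P pc = IBr g ->
  reach pc (g (read tp)).2 tp (mv (g (read tp)).1.2 (write (g (read tp)).1.1 tp)) 1.
Proof.
move=> pcP pcE fuel b qs qok ex; exists qs => //.
by rewrite /= inordK ?ltnS 1?ltnW // pcE.
Qed.

Lemma reach_qry pc n tp : pc < size P -> nth (IHalt false) P pc = IQry n -> ok (query_val tp) ->
  reach pc n tp (answer O tp) 1.
Proof.
move=> pcP pcE okq fuel b qs qok ex; exists (query_val tp :: qs); first by rewrite /= okq.
by rewrite /= inordK ?ltnS 1?ltnW // pcE /= ex.
Qed.

Definition code_at (a : nat) (l : seq instr) : Prop := exists s1 s2, P = s1 ++ l ++ s2 /\ size s1 = a.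

Lemma code_at_cat a l1 l2 : code_at a (l1 ++ l2) -> code_at a l1 /\ code_at (a + size l1) l2.
Proof.
case=> [s1 [s2 [PE sE]]]; split; first by exists s1, (l2 ++ s2); rewrite PE -!catA.
by exists (s1 ++ l1), s2; rewrite size_cat sE PE -!catA.
Qed.

Lemma code_at_cons a i l : code_at a (i :: l) ->
  [/\ a < size P, nth (IHalt false) P a = i & code_at a.+1 l].
Proof.
case=> [s1 [s2 [PE sE]]]; split.
- by rewrite PE !size_cat /= sE; lia.
- by rewrite PE nth_cat sE ltnn subnn.
- by exists (rcons s1 i), s2; rewrite size_rcons sE PE cat_rcons.
Qed.

Lemma compile_reach c tp tp' n : ev c tp tp' n -> forall a nxt, code_at a (compile c a nxt) ->
  exists2 k, k <= n & reach a nxt tp tp' k.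
Proof.
elim=> {c tp tp' n} [g tp n n0|tp n okq n0|c1 c2 tp tp1 tp2 n1 n2 n _ IH1 _ IH2 le_n
  |f tp tp1 n1 n _ IH lt_n|f tp n rd n0|f b tp tp1 tp2 n1 n2 n rd _ IH1 _ IH2 lt_n] a nxt /=.
- case/code_at_cons=> aP aE _; exists 1 => //.
  exact: (@reach_br _ _ tp aP aE).
- case/code_at_cons=> aP aE _; exists 1 => //; exact: reach_qry.
- case/code_at_cat; rewrite size_compile => /IH1 [k1 k1n r1] /IH2 [k2 k2n r2].
  exists (k1 + k2); first by lia.
  exact: reach_trans r1 r2.
- case/code_at_cons=> aP aE /code_at_cat [c0' /code_at_cat []]; rewrite !size_compile => c1' c2'.
  have r1 := @reach_br _ _ tp aP aE.
  have [k kn r2] : exists2 k, k <= n1 & reach (match read tp with None => a.+1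
      | Some false => a.+1 + code_size (f None)
      | Some true => a.+1 + code_size (f None) + code_size (f (Some false)) end) nxt (touch tp) tp1 k.
    by move: IH; case: (read tp) => [[]|] IH; apply: IH.
  exists (1 + k); first by lia.
  exact: reach_trans r1 r2.
- case/code_at_cons=> aP aE _; exists 1 => //.
  by have := @reach_br _ _ tp aP aE; rewrite /touch rd.
- move=> codeW; have [k2 k2n r3] := IH2 a nxt codeW.
  case/code_at_cons: codeW => aP aE /code_at_cat; rewrite !size_compile => -[c0 c1].
  have r1 := @reach_br _ _ tp aP aE.
  have [k kn r2] : exists2 k, k <= n1 & reach (match read tp with None => nxt
      | Some false => a.+1 | Some true => a.+1 + code_size (f false) end) a (touch tp) tp1 k.
    by rewrite rd; case: b IH1 {rd} => IH1; apply: IH1.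
  exists (1 + k + k2); first by lia.
  exact: reach_trans (reach_trans r1 r2) r3.
Qed.

End Compile.

(** The verdict is read under the final head position: a blank accepts. *)
Definition with_halt (c : tm) : seq instr :=
  let L := code_size c in
  compile c 0 L ++ [:: IBr (fun x => (x, Stay, if x is None then L.+1 else L.+2));
                    IHalt true; IHalt false].

Lemma exec_with_halt c tp tp' n : ev c tp tp' n ->
  exists T, T <= n.+2 /\ exists qs,
    @exec (machine (with_halt c)) O T (start (machine (with_halt c))) tp
      = Some (read tp' == None, qs) /\ all ok qs.
Proof.
move=> evc; pose P := with_halt c.
have PE : P = compile c 0 (code_size c) ++ [:: IBr (fun x => (x, Stay,
    if x is None then (code_size c).+1 else (code_size c).+2)); IHalt true; IHalt false] by [].
have [k kn r1] := compile_reach (P := P) evc (nxt := code_size c)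
  (ex_intro _ [::] (ex_intro _ _ (conj PE erefl))).
have nthP i : nth (IHalt false) P (code_size c + i) = nth (IHalt false) [:: IBr (fun x => (x, Stay,
    if x is None then (code_size c).+1 else (code_size c).+2)); IHalt true; IHalt false] i.
  by rewrite PE nth_cat size_compile ltnNge leq_addr /= addKn.
have szP : size P = code_size c + 3 by rewrite PE size_cat size_compile.
have cP : code_size c < size P by rewrite szP; lia.
have r2 := @reach_br P (code_size c) _ tp' cP (etrans (congr1 _ (esym (addn0 _))) (nthP 0)).
have ex : @exec (machine P) O 1 (inord (if read tp' is None then (code_size c).+1 else (code_size c).+2)
    : 'I_(size P).+1) (touch tp') = Some (read tp' == None, [::]).
  have e1 := nthP 1; have e2 := nthP 2; rewrite addn1 /= in e1; rewrite addn2 /= in e2.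
  by case: (read tp') => [x|] /=; rewrite inordK ?szP ?e1 ?e2 //; lia.
have [qs qok exq] := reach_trans r1 r2 (isT : all ok [::]) ex.
exists (k + 1 + 1); split; first by lia.
exists qs; split=> //; rewrite -exq; congr exec.
by apply: val_inj; rewrite /= inordK.
Qed.

End Semantics.

(** * Stacks on the tape *)

(* Each stack is followed by a blank, with its top on the left; [enc'] puts the blanks
   in front instead, which is what a head moving left sees. *)
Fixpoint enc (r : seq (seq bool)) : seq (option bool) :=
  if r is s :: r' then map Some s ++ None :: enc r' else [::].

Fixpoint enc' (r : seq (seq bool)) : seq (option bool) :=
  if r is s :: r' then None :: map Some s ++ enc' r' else [::].

Lemma enc_cat r1 r2 : enc (r1 ++ r2) = enc r1 ++ enc r2.
Proof. by elim: r1 => //= s r1 ->; rewrite -catA. Qed.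

Lemma enc'_cat r1 r2 : enc' (r1 ++ r2) = enc' r1 ++ enc' r2.
Proof. by elim: r1 => //= s r1 ->; rewrite -catA. Qed.

Lemma enc_enc' r : None :: enc r = enc' r ++ [:: None].
Proof. by elim: r => //= s r ->; rewrite catA. Qed.

Lemma rev_enc r l : rev (enc r) ++ None :: l = None :: rev (enc' r) ++ l.
Proof.
have := congr1 (fun x => rev x ++ l) (enc_enc' r).
by rewrite rev_cons rev_cat cat_rcons.
Qed.

Definition tR := TDo (fun c => (c, MoveR)).
Definition tL := TDo (fun c => (c, MoveL)).
Definition tNop := TDo (fun c => (c, Stay)).
Definition tW w m := TDo (fun _ => (w, m)).

Fixpoint tIter (n : nat) (c : tm) : tm := if n is n'.+1 then TSeq c (tIter n' c) else tNop.

Definition tGoto i := tIter i (TSeq (TWhile (fun _ => tR)) tR).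
(** Leftward loops stop at the blank in front of a stack. One blank is therefore kept in front of
    the first stack, and the home position is the cell after it. *)
Definition tBack i := tIter i (TSeq tL (TWhile (fun _ => tL))).
Definition tHome i := TSeq tL (TSeq (tBack i) tR).
(* Opens a free cell by moving [i] stacks one cell to the right, the last one first. *)
Definition tShift i := tIter i (TSeq tR (TSeq (tW None MoveL) (TSeq tL
  (TWhile (fun b => TSeq tR (TSeq (tW (Some b) MoveL) tL)))))).
(** Copies a stack one cell to the left, over the cell before it, and blanks the cell thus freed, so
    that the next stack can follow in the same way. *)
Definition tDelSeg := TSeq (TWhile (fun b => TSeq (tW (Some b) MoveL) (TSeq (tW (Some b) MoveR) tR)))
  (TSeq (tW None MoveL) (TSeq (tW None MoveR) tR)).
(** From the last delimiter leftwards, the stacks from index [i] on are shifted right, which frees a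
    cell on top of stack [i]. *)
Definition tPush k i b := TSeq (tGoto k) (TSeq tL (TSeq (tShift (k - i))
  (TSeq tR (TSeq (tW (Some b) MoveL) (TSeq (tBack i) tR))))).
Definition tDel k i := TSeq tR (TSeq tDelSeg (TSeq (tIter (k - i.+1) tDelSeg)
  (TSeq tL (tHome k)))).

Section Moves.
Variables (O : nat -> nat) (ok : pred nat).
Notation ev := (ev O ok).

Lemma ev_do g l x r : ev (TDo g) (Tape l (x :: r)) (mv (g x).2 (Tape l ((g x).1 :: r))) 1.
Proof. exact: EvDo. Qed.

Lemma ev_le c tp tp' n m : ev c tp tp' n -> n <= m -> ev c tp tp' m.
Proof.
case=> [g tp0 n0 n00|tp0 n0 okq n00|a b tp0 tp1 tp2 n1 n2 n0 e1 e2 le|f tp0 tp1 n1 n0 e1 lt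
  |f tp0 n0 rd n00|f b tp0 tp1 tp2 n1 n2 n0 rd e1 e2 lt] nm.
- by apply: EvDo; apply: leq_trans nm.
- by apply: EvQry => //; apply: leq_trans nm.
- by apply: EvSeq e1 e2 _; apply: leq_trans nm.
- by apply: EvSw e1 _; apply: leq_trans nm.
- by apply: EvWhileEnd => //; apply: leq_trans nm.
- by apply: EvWhileStep rd e1 e2 _; apply: leq_trans nm.
Qed.

Lemma ev_seq a b tp tp1 tp2 n1 n2 :
  ev a tp tp1 n1 -> ev b tp1 tp2 n2 -> ev (TSeq a b) tp tp2 (n1 + n2).
Proof. by move=> e1 e2; apply: EvSeq e1 e2 _. Qed.

Ltac do_three := eapply (ev_seq (n1 := 1) (n2 := 2)); [apply: ev_do|];
  eapply (ev_seq (n1 := 1) (n2 := 1)); apply: ev_do.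

Lemma ev_walkR s l rest : ev (TSeq (TWhile (fun _ => tR)) tR) (Tape l (map Some s ++ None :: rest))
  (Tape (None :: rev (map Some s) ++ l) rest) (2 * (size s).+1).
Proof.
apply: (@EvSeq _ _ _ _ _ (Tape (rev (map Some s) ++ l) (None :: rest)) _ (2 * size s).+1 1); try lia.
  elim: s l => [|b s IH] l; first exact: EvWhileEnd.
  apply: (EvWhileStep (b := b)); [by []|exact: ev_do|rewrite /= rev_cons cat_rcons; exact: IH|].
  by rewrite /=; lia.
exact: ev_do.
Qed.

Lemma ev_goto r l rest : ev (tGoto (size r)) (Tape l (enc r ++ rest))
  (touch (Tape (rev (enc r) ++ l) rest)) (2 * size (enc r)).+1.
Proof.
elim: r l => [|s r IH] l /=; first by apply: EvDo.
have -> : rev (map Some s ++ None :: enc r) ++ l = rev (enc r) ++ None :: rev (map Some s) ++ l.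
  by rewrite rev_cat rev_cons cat_rcons -catA.
rewrite -catA; apply: (EvSeq (ev_walkR s l _) (IH _)).
by rewrite size_cat /= size_map; lia.
Qed.

(** [t] lists the symbols in the order in which the leftward head meets them, starting under the
    head; in its use it is a reversed stack. *)
Lemma ev_walkL t l x u r : x :: u = map Some t ++ None :: l ->
  ev (TWhile (fun _ => tL)) (Tape u (x :: r)) (Tape l (None :: catrev (map Some t) r)) (2 * size t).+1.
Proof.
elim: t x u r => [|b t IH] x u r /= [-> ->]; first exact: EvWhileEnd.
have [y [v yv]] : exists y v, map Some t ++ None :: l = y :: v.
  by case: (t) => [|b' t'] /=; do 2 eexists.
rewrite yv in IH *.
apply: (EvWhileStep (b := b) (tp1 := Tape v (y :: Some b :: r)) (n1 := 1)); first by [].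
- exact: ev_do.
- exact: IH.
- by rewrite /=; lia.
Qed.

Lemma ev_back r l R : ev (tBack (size r)) (Tape (rev (enc' r) ++ l) (None :: R))
  (Tape l (None :: enc r ++ R)) (2 * size (enc r)).+1.
Proof.
elim/last_ind: r R => [|r s IH] R; first exact: ev_do.
rewrite size_rcons -cats1 enc'_cat enc_cat /= cats0 rev_cat rev_cons -!catA.
have [y [v yv]] : exists y v, rev (map Some s) ++ None :: rev (enc' r) ++ l = y :: v.
  by case: (rev _) => [|b' t'] /=; do 2 eexists.
rewrite cat_rcons yv.
have e1 := ev_do (fun c => (c, MoveL)) (y :: v) None R.
have e2 := @ev_walkL (rev s) (rev (enc' r) ++ l) y v (None :: R).
rewrite map_rev -yv catrevE revK size_rev in e2.
apply: (EvSeq (ev_seq e1 (e2 erefl)) (IH _)).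
by rewrite size_cat /= size_cat size_map /=; lia.
Qed.

Lemma ev_home r x rest : ev (tHome (size r)) (Tape (rev (enc r) ++ [:: None]) (x :: rest))
  (Tape [:: None] (enc r ++ x :: rest)) (2 * size (enc r) + 3).
Proof.
rewrite rev_enc.
have e1 := ev_do (fun c => (c, MoveL)) (None :: rev (enc' r) ++ [::]) x rest.
have e3 := ev_do (fun c => (c, MoveR)) [::] None (enc r ++ x :: rest).
by apply: (EvSeq e1 (ev_seq (ev_back r [::] _) e3)); lia.
Qed.

(** Each round copies the bit under the head into the free cell [g] on its right, and the old cell
    of the bit becomes free. The content [y] left in the last free cell is arbitrary. *)
Lemma ev_shiftloop t l x u g R : x :: u = map Some t ++ None :: l -> exists y,
  ev (TWhile (fun b => TSeq tR (TSeq (tW (Some b) MoveL) tL))) (Tape u (x :: g :: R))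
     (Tape l (None :: y :: catrev (map Some t) R)) (4 * size t).+1.
Proof.
elim: t x u g R => [|b t IH] x u g R /= [-> ->]; first by exists g; apply: EvWhileEnd.
have [y [v yv]] : exists y v, map Some t ++ None :: l = y :: v.
  by case: (t) => [|b' t'] /=; do 2 eexists.
rewrite yv in IH *.
have [z e2] := IH y v (Some b) (Some b :: R) erefl.
exists z.
apply: (EvWhileStep (b := b) (tp1 := Tape v (y :: Some b :: Some b :: R)) (n1 := 3)).
- by [].
- do_three.
- exact: e2.
- by lia.
Qed.

Lemma ev_shift r l x R : exists y, ev (tShift (size r))
  (Tape (rev (enc' r) ++ l) (None :: x :: R)) (Tape l (None :: y :: enc r ++ R))
  (4 * size (enc r)).+1.
Proof.
elim/last_ind: r x R => [|r s IH] x R; first by exists x; apply: ev_do.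
rewrite size_rcons -cats1 enc'_cat enc_cat /= cats0 rev_cat rev_cons -!catA.
have [y [v yv]] : exists y v, rev (map Some s) ++ None :: rev (enc' r) ++ l = y :: v.
  by case: (rev _) => [|b' t'] /=; do 2 eexists.
rewrite cat_rcons yv.
have e1 := ev_do (fun c => (c, MoveR)) (y :: v) None (x :: R).
have e1' := ev_do (fun _ => (None, MoveL)) (None :: y :: v) x R.
have e1'' := ev_do (fun c => (c, MoveL)) (y :: v) None (None :: R).
have [g e2] := @ev_shiftloop (rev s) (rev (enc' r) ++ l) y v None (None :: R)
  (etrans (esym yv) (congr1 (fun x => x ++ _) (esym (map_rev _ _)))).
rewrite map_rev catrevE revK size_rev in e2.
have [z e3] := IH g (map Some s ++ None :: R).
exists z; apply: (EvSeq (ev_seq e1 (ev_seq e1' (ev_seq e1'' e2))) e3).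
by rewrite size_cat /= size_cat size_map /=; lia.
Qed.

(** The number of explicit blanks after the last stack is left existential: the shift uses up one,
    which is created beforehand if there is none. *)
Lemma ev_push r1 s r2 b m : exists m',
  ev (tPush (size (r1 ++ s :: r2)) (size r1) b)
    (Tape [:: None] (enc (r1 ++ s :: r2) ++ nseq m None))
    (Tape [:: None] (enc (r1 ++ (b :: s) :: r2) ++ nseq m' None))
    (10 * size (enc (r1 ++ s :: r2)) + 12).
Proof.
set r := r1 ++ s :: r2; exists m.-1; rewrite /tPush.
have e1 := ev_goto r [:: None] (nseq m None).
have -> : (size r - size r1)%N = size (s :: r2) by rewrite /r size_cat addKn.
rewrite rev_enc cats0 in e1.
have touchE : touch (Tape (None :: rev (enc' r)) (nseq m None))
   = Tape (None :: rev (enc' r)) (None :: nseq m.-1 None) by case: (m).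
rewrite touchE in e1.
have e2 := ev_do (fun c => (c, MoveL)) (None :: rev (enc' r)) None (nseq m.-1 None).
have rE : rev (enc' r) = rev (enc' (s :: r2)) ++ rev (enc' r1) by rewrite /r enc'_cat rev_cat.
rewrite /= rE in e1 e2.
have [y e3] := ev_shift (s :: r2) (rev (enc' r1)) None (nseq m.-1 None).
have e4 := ev_do (fun c => (c, MoveR)) (rev (enc' r1)) None (y :: enc (s :: r2) ++ nseq m.-1 None).
have e5 := ev_do (fun _ => (Some b, MoveL)) (None :: rev (enc' r1)) y (enc (s :: r2) ++ nseq m.-1 None).
have e6 := ev_back r1 [::] (Some b :: enc (s :: r2) ++ nseq m.-1 None).
rewrite cats0 in e6.
have e7 := ev_do (fun c => (c, MoveR)) [::] None (enc r1 ++ Some b :: enc (s :: r2) ++ nseq m.-1 None).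
have -> : enc (r1 ++ (b :: s) :: r2) ++ nseq m.-1 None = enc r1 ++ Some b :: enc (s :: r2) ++ nseq m.-1 None.
  by rewrite enc_cat -catA.
apply: (EvSeq e1 (ev_seq e2 (ev_seq e3 (ev_seq e4 (ev_seq e5 (ev_seq e6 e7)))))).
rewrite /r enc_cat size_cat; lia.
Qed.

Lemma ev_delseg s g l R : ev tDelSeg (Tape (g :: l) (map Some s ++ None :: R))
  (Tape (None :: None :: rev (map Some s) ++ l) R) (4 * (size s).+1).
Proof.
apply: (@EvSeq _ _ _ _ _ (Tape (last g (map Some s) :: rev (map Some s) ++ l) (None :: R)) _
   (4 * size s).+1 3); last by lia.
  elim: s g l => [|b s IH] g l; first exact: EvWhileEnd.
  apply: (EvWhileStep (b := b) (tp1 := Tape (Some b :: Some b :: l) (map Some s ++ None :: R)) (n1 := 3)).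
  - by [].
  - do_three.
  - by rewrite /= rev_cons cat_rcons; apply: IH.
  - by rewrite /=; lia.
do_three.
Qed.

Lemma ev_delsegs r l R : ev (tIter (size r) tDelSeg) (Tape (None :: l) (enc r ++ R))
  (touch (Tape (None :: rev (enc r) ++ l) R)) (4 * size (enc r)).+1.
Proof.
elim: r l => [|s r IH] l; first by apply: EvDo.
have -> : rev (enc (s :: r)) ++ l = rev (enc r) ++ None :: rev (map Some s) ++ l.
  by rewrite /= rev_cat rev_cons cat_rcons -catA.
rewrite /= -catA; apply: (EvSeq (ev_delseg s None l _) (IH _)).
by rewrite size_cat /= size_map; lia.
Qed.

Lemma ev_del r1 b s r2 m : exists m',
  ev (tDel (size (r1 ++ (b :: s) :: r2)) (size r1))
    (Tape (rev (enc r1) ++ [:: None]) (enc ((b :: s) :: r2) ++ nseq m None))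
    (Tape [:: None] (enc (r1 ++ s :: r2) ++ nseq m' None))
    (6 * size (enc (r1 ++ (b :: s) :: r2)) + 10).
Proof.
exists m.-1.+2; rewrite /tDel; set l := rev (enc r1) ++ _.
have -> : (size (r1 ++ (b :: s) :: r2) - (size r1).+1)%N = size r2.
  by rewrite size_cat /= addnS subSS addKn.
set r := r1 ++ s :: r2.
have -> : size (r1 ++ (b :: s) :: r2) = size r by rewrite !size_cat.
have e1 := ev_do (fun c => (c, MoveR)) l (Some b) (map Some s ++ None :: enc r2 ++ nseq m None).
have e2 := ev_delseg s (Some b) l (enc r2 ++ nseq m None).
have e3 := ev_delsegs r2 (None :: rev (map Some s) ++ l) (nseq m None).
have lE : rev (enc r2) ++ None :: rev (map Some s) ++ l = rev (enc r) ++ [:: None].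
  by rewrite /l /r enc_cat /= !rev_cat rev_cons -!catA cat_rcons.
rewrite lE in e3.
have touchE L : touch (Tape L (nseq m None)) = Tape L (None :: nseq m.-1 None) by case: (m).
rewrite touchE in e3.
have e4 := ev_do (fun c => (c, MoveL)) (None :: rev (enc r) ++ [:: None]) None (nseq m.-1 None).
have e5 := ev_home r None (None :: nseq m.-1 None).
rewrite /= -catA.
apply: (EvSeq e1 (ev_seq e2 (ev_seq e3 (ev_seq e4 e5)))).
rewrite /r !enc_cat /= !size_cat /= !size_cat /= !size_map; lia.
Qed.

End Moves.

Local Notation regs := (seq (seq bool)).
Local Notation get r i := (nth [::] r i).
Local Notation put r i v := (set_nth [::] r i v).
Local Notation nval := nat_of_bits.

(** * Stack programs and their simulation on the tape *)

(** Stacks are inspected only by popping: [SCase] and [SWhile] remove the top on which they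
    branch. *)
Inductive scmd :=
  | SSkip
  | SPush of nat & bool
  | SQry of nat
  | SSeq of scmd & scmd
  | SCase of nat & (option bool -> scmd)
  | SWhile of nat & (bool -> scmd).

Section StackSemantics.
Variables (O : nat -> nat) (ok : pred nat).

Inductive sev : scmd -> regs -> regs -> nat -> Prop :=
  | SevSkip r n : 0 < n -> sev SSkip r r n
  | SevPush i b r n : i < size r -> 0 < n -> sev (SPush i b) r (put r i (b :: get r i)) n
  | SevQry i r n : i < size r -> ok (nat_of_bits (get r i)) -> 0 < n ->
      sev (SQry i) r (put r i (bits_of (O (nat_of_bits (get r i))))) n
  | SevSeq a b r r1 r2 n1 n2 n : sev a r r1 n1 -> sev b r1 r2 n2 -> n1 + n2 <= n ->
      sev (SSeq a b) r r2 n
  | SevCase i f r r1 n1 n : i < size r -> sev (f (ohead (get r i))) (put r i (behead (get r i))) r1 n1 ->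
      n1 < n -> sev (SCase i f) r r1 n
  | SevWhileEnd i f r n : i < size r -> get r i = [::] -> 0 < n -> sev (SWhile i f) r r n
  | SevWhileStep i f b s r r1 r2 n1 n2 n : i < size r -> get r i = b :: s ->
      sev (f b) (put r i s) r1 n1 -> sev (SWhile i f) r1 r2 n2 -> n1 + n2 < n ->
      sev (SWhile i f) r r2 n.

(** The loop body ends with [tGoto i] so that [TWhile] tests the top of stack [i] again. An oracle
    answer replaces exactly the queried word, so the later stacks remain intact behind it. *)
Fixpoint tr (k : nat) (c : scmd) : tm :=
  match c with
  | SSkip => tNop
  | SPush i b => tPush k i b
  | SQry i => TSeq (tGoto i) (TSeq TQry (tHome i))
  | SSeq a b => TSeq (tr k a) (tr k b)
  | SCase i f => TSeq (tGoto i) (TSw (fun c =>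
      if c is Some b then TSeq (tDel k i) (tr k (f (Some b))) else TSeq (tHome i) (tr k (f None))))
  | SWhile i f => TSeq (tGoto i) (TSeq (TWhile (fun b =>
      TSeq (tDel k i) (TSeq (tr k (f b)) (tGoto i)))) (tHome i))
  end.

Definition home_tape (r : regs) (m : nat) : tape := Tape [:: None] (enc r ++ nseq m None).

Lemma regs_split (r : regs) i : i < size r ->
  exists r1 r2, [/\ size r1 = i, r = r1 ++ get r i :: r2 & forall v, put r i v = r1 ++ v :: r2].
Proof.
move=> ir; exists (take i r), (drop i.+1 r); rewrite size_takel ?(ltnW ir) //; split=> //.
  by rewrite -drop_nth // cat_take_drop.
by move=> v; rewrite set_nthE ir.
Qed.

Lemma ev_seq_inv a b tp tp2 n : ev O ok (TSeq a b) tp tp2 n ->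
  exists tp1 n1 n2, [/\ ev O ok a tp tp1 n1, ev O ok b tp1 tp2 n2 & n1 + n2 <= n].
Proof.
move=> H; inversion H; subst.
by do 3 eexists; split; eassumption.
Qed.

Lemma size_put (r : regs) i v : i < size r -> size (put r i v) = size r.
Proof. by move=> ir; rewrite size_set_nth; apply/maxn_idPr. Qed.

Lemma bit_prefix_cat s r : bit_prefix (map Some s ++ None :: r) = s.
Proof. by elim: s => //= b s ->. Qed.

Lemma sev_size c r r' n : sev c r r' n -> size r' = size r.
Proof.
by elim=> {c r r' n} // [i b r n ir _|i r n ir _ _|a b r r1 r2 n1 n2 n _ -> _ ->|i f r r1 n1 n ir _ -> _
  |i f b s r r1 r2 n1 n2 n ir _ _ e1 _ -> _] //; rewrite ?e1 size_put.
Qed.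

Lemma goto_seg k (r : regs) i m : i < size r -> size r = k -> exists r1 r2,
  [/\ size r1 = i, r = r1 ++ get r i :: r2, forall v, put r i v = r1 ++ v :: r2 &
  ev O ok (tGoto i) (home_tape r m) (Tape (rev (enc r1) ++ [:: None])
     (map Some (get r i) ++ None :: enc r2 ++ nseq m None)) (2 * size (enc r)).+1].
Proof.
move=> ir rk; have [r1 [r2 [s1 rE putE]]] := regs_split ir.
exists r1, r2; split=> //.
have := ev_goto O ok r1 [:: None] (enc (get r i :: r2) ++ nseq m None).
rewrite s1 catA -enc_cat -rE => h.
apply: (@ev_le _ _ _ _ _ (2 * size (enc r1)).+1); last first.
  by rewrite [in X in _ <= X]rE enc_cat size_cat; lia.
rewrite /home_tape; move: h; rewrite /= -catA /=.
by case: (get r i).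
Qed.

Variable W : nat.
Hypothesis W0 : 0 < W.
Hypothesis WO : forall x, size (bits_of (O x)) <= W.

Lemma enc_put (r : regs) i v : i < size r ->
  size (enc (put r i v)) + size (get r i) = size (enc r) + size v.
Proof.
move=> ir; have [r1 [r2 [_ rE putE]]] := regs_split ir.
by rewrite putE [in RHS]rE !enc_cat !size_cat /= ?size_cat /= !size_map; lia.
Qed.

(** A push adds one cell, and an answer at most [W] cells. *)
Lemma sev_enc c r r' n : sev c r r' n -> size (enc r') <= size (enc r) + n * W.
Proof.
elim=> {c r r' n} [r n n0|i b r n ir n0|i r n ir okq n0|a b r r1 r2 n1 n2 n _ e1 _ e2 le
  |i f r r1 n1 n ir _ e1 lt|i f r n ir _ n0|i f b s r r1 r2 n1 n2 n ir sE _ e1 _ e2 lt].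
- by lia.
- have := enc_put (b :: get r i) ir; rewrite /=; nia.
- have := enc_put (bits_of (O (nat_of_bits (get r i)))) ir.
  have := WO (nat_of_bits (get r i)); nia.
- nia.
- have := enc_put (behead (get r i)) ir; rewrite size_behead; nia.
- by lia.
- have := enc_put s ir; rewrite sE /=; nia.
Qed.

(** Each stack operation sweeps the tape a bounded number of times, and [E] bounds its encoded
    length throughout. The bound [E] is arbitrary so that all parts of a run can use the same
    one. *)
Lemma sim k c r r' n : sev c r r' n -> size r = k -> forall m, exists m', forall E,
  size (enc r) + n * W <= E -> ev O ok (tr k c) (home_tape r m) (home_tape r' m') (n * (10 * E + 20)).
Proof.
elim=> {c r r' n} [r n n0|i b r n ir n0|i r n ir okq n0|a b r r1 r2 n1 n2 n s1 e1 s2 e2 le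
  |i f r r1 n1 n ir s1 e1 lt|i f r n ir rd n0|i f b s r r1 r2 n1 n2 n ir sE s1 e1 s2 e2 lt] rk m /=.
- case yE : (enc r ++ nseq m None) => [|y rest].
    exists 1 => E _.
    have -> : home_tape r 1 = touch (home_tape r m).
      by rewrite /home_tape yE /touch /=; case: (enc r) yE.
    by apply: EvDo; nia.
  exists m => E _.
  have {2}-> : home_tape r m = touch (home_tape r m) by rewrite /home_tape yE.
  by apply: EvDo; nia.
- have [q1 [q2 [sz rE putE]]] := regs_split ir.
  have [m' e] := ev_push O ok q1 (get r i) q2 b m.
  rewrite -rE sz rk -putE in e.
  exists m' => E le; apply: ev_le e _; nia.
- have [q1 [q2 [sz rE putE e]]] := goto_seg m ir rk.
  exists m => E le.
  have okq' : ok (query_val (Tape (rev (enc q1) ++ [:: None])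
     (map Some (get r i) ++ None :: enc q2 ++ nseq m None))).
    by rewrite /query_val /= bit_prefix_cat.
  have e2 := EvQry O okq' (leqnn 1).
  rewrite /answer /= bit_prefix_cat drop_cat size_map ltnn subnn drop0 in e2.
  set v := bits_of _ in e2 *.
  have [x [rest xE]] : exists x rest, map Some v ++ None :: enc q2 ++ nseq m None = x :: rest.
    by case: (v) => [|x rest]; do 2 eexists; reflexivity.
  have e3 := ev_home O ok q1 x rest.
  rewrite -xE sz in e3.
  have hE : home_tape (put r i v) m = Tape [:: None] (enc q1 ++ map Some v ++ None :: enc q2 ++ nseq m None).
    by rewrite /home_tape putE enc_cat /= -!catA.
  rewrite hE; apply: (EvSeq e (EvSeq e2 e3 (leqnn _))).
  have : size (enc q1) <= size (enc r) by rewrite [in X in _ <= X]rE enc_cat size_cat leq_addr.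
  nia.
- have [m1 {}e1] := e1 rk m; have [m2 {}e2] := e2 (etrans (sev_size s1) rk) m1.
  exists m2 => E hE; have l1 := sev_enc s1.
  apply: (EvSeq (e1 E _) (e2 E _)); nia.
- have rk' : size (put r i (behead (get r i))) = k by rewrite size_put.
  have [q1 [q2 [sz rE putE e]]] := goto_seg m ir rk.
  case gE : (get r i) e s1 e1 rk' rE => [|b s] /= e s1 e1 rk' rE.
    have putr : put r i [::] = r by rewrite putE -rE.
    rewrite putr in e1 s1.
    have e2 := ev_home O ok q1 None (enc q2 ++ nseq m None).
    have hE : home_tape r m = Tape [:: None] (enc q1 ++ None :: enc q2 ++ nseq m None).
      by rewrite {1}rE /home_tape enc_cat -catA.
    rewrite -hE sz in e2.
    have [m' {}e1] := e1 rk m.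
    exists m' => E le.
    have e3 : ev O ok (tr k (f None)) (home_tape r m) (home_tape r1 m') (n1 * (10 * E + 20)).
      by apply: e1; nia.
    apply: (EvSeq e (EvSw _ (leqnn _))); first by apply: (ev_seq e2 e3).
    have : size (enc q1) <= size (enc r) by rewrite [in X in _ <= X]rE enc_cat size_cat leq_addr.
    nia.
  have [m1 e2] := ev_del O ok q1 b s q2 m.
  rewrite -rE sz rk -putE in e2.
  have [m' {}e1] := e1 rk' m1.
  exists m' => E le.
  have e3 : ev O ok (tr k (f (Some b))) (home_tape (put r i s) m1) (home_tape r1 m') (n1 * (10 * E + 20)).
    by apply: e1; have := enc_put s ir; rewrite gE /=; nia.
  rewrite /= -catA /= in e2.
  apply: (EvSeq e (EvSw _ (leqnn _))); first by apply: (ev_seq e2 e3).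
  nia.
- have [q1 [q2 [sz rE putE e]]] := goto_seg m ir rk.
  rewrite rd /= in e rE.
  have e2 := ev_home O ok q1 None (enc q2 ++ nseq m None).
  have hE : home_tape r m = Tape [:: None] (enc q1 ++ None :: enc q2 ++ nseq m None).
    by rewrite {1}rE /home_tape enc_cat -catA.
  rewrite -hE sz in e2.
  exists m => E le.
  have ew F := @EvWhileEnd O ok F (Tape (rev (enc q1) ++ [:: None]) (None :: enc q2 ++ nseq m None))
    1 erefl isT.
  apply: (EvSeq e (ev_seq (ew _) e2)).
  have : size (enc q1) <= size (enc r) by rewrite [in X in _ <= X]rE enc_cat size_cat leq_addr.
  nia.
- have rk' : size (put r i s) = k by rewrite size_put.
  have [q1 [q2 [sz rE putE e]]] := goto_seg m ir rk.
  rewrite sE /= in e rE.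
  have [m1 e3] := ev_del O ok q1 b s q2 m.
  rewrite -rE sz rk -putE /= -catA /= in e3.
  have [m2 {}e1] := e1 rk' m1.
  have [m3 {}e2] := e2 (etrans (sev_size s1) rk') m2.
  exists m3 => E le.
  have szs := enc_put s ir; rewrite sE /= in szs.
  have l1 := sev_enc s1.
  have {}e1 : ev O ok (tr k (f b)) (home_tape (put r i s) m1) (home_tape r1 m2) (n1 * (10 * E + 20)).
    by apply: e1; nia.
  have {}e2 : ev O ok (tr k (SWhile i f)) (home_tape r1 m2) (home_tape r2 m3) (n2 * (10 * E + 20)).
    by apply: e2; nia.
  (* The simulation of the remaining loop is cut open: its initial [tGoto i] closes the current
     round, and only its [TWhile] continues the loop. *)
  have [tp1 [n3 [n4 [g1 /ev_seq_inv [tp2 [n5 [n6 [g2 g3 le6]]]] le4]]]] := ev_seq_inv e2.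
  have ew := @EvWhileStep O ok _ b (Tape (rev (enc q1) ++ [:: None])
    (Some b :: map Some s ++ None :: enc q2 ++ nseq m None)) _ _ _ _ _ erefl
    (ev_seq e3 (ev_seq e1 g1)) g2 (leqnn _).
  apply: (EvSeq e (EvSeq ew g3 (leqnn _))).
  nia.
Qed.

End StackSemantics.

(** * Modular arithmetic on stacks *)

Lemma val_cons b s : nval (b :: s) = b + 2 * nval s.
Proof. by rewrite /= -mul2n. Qed.

Lemma val_lt s : nval s < 2 ^ size s.
Proof. by elim: s => //= b s IH; rewrite -mul2n expnS; case: b; lia. Qed.

(** An exhausted stack yields zeros, which pads short numbers to the length of [p]. *)
Definition bit_of (o : option bool) : bool := odflt false o.
Definition hbit (s : seq bool) : bool := bit_of (ohead s).

Lemma val_hd s : nval s = hbit s + 2 * nval (behead s).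
Proof. by case: s => [|b s] //; rewrite val_cons /=; case: b. Qed.

Lemma bits_aux_val k n : n <= k -> nval (bits_aux k n) = n.
Proof.
elim: k n => [|k IH] n nk /=; first by case: n nk.
case: eqP => [->//|/eqP n0]; rewrite val_cons IH.
  by rewrite mul2n odd_double_half.
rewrite -ltnS; apply: leq_trans nk; have := odd_double_half n; lia.
Qed.

Lemma bits_of_val n : nval (bits_of n) = n.
Proof. exact: bits_aux_val. Qed.

Lemma size_bits_aux k n l : n <= k -> n < 2 ^ l -> size (bits_aux k n) <= l.
Proof.
elim: k n l => [|k IH] n l nk nl //=.
case: eqP => // /eqP n0 /=; case: l nl => [|l]; first by rewrite expn0; lia.
rewrite expnS => nl; have := odd_double_half n => on.
by rewrite ltnS; apply: IH; lia.
Qed.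

Lemma size_bits_of n l : n < 2 ^ l -> size (bits_of n) <= l.
Proof. exact: size_bits_aux. Qed.

Lemma size_bits_ge n : n < 2 ^ size (bits_of n).
Proof. by rewrite -[X in X < _]bits_of_val val_lt. Qed.

Lemma size_bits_le n : 0 < n -> 2 ^ (size (bits_of n)).-1 <= n.
Proof.
move=> n0; rewrite leqNgt; apply/negP => /size_bits_of.
have : 0 < size (bits_of n) by have := size_bits_ge n; case: (size _) => //; rewrite expn0; lia.
by move=> s0; rewrite leqNgt prednK // leqnn.
Qed.

Lemma size_bits_mono m n : m <= n -> size (bits_of m) <= size (bits_of n).
Proof. by move=> mn; apply: size_bits_of; apply: leq_ltn_trans mn (size_bits_ge n). Qed.

(* Registers: 0 [p]; 1 [e]; 2 [t], later [p - t]; 3 loop counter in unary; 4 [z];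
   5 [p - 2]; 6 base; 7 multiplicand; 8 accumulator; 9 second summand; 10 multiplier,
   high bit on top; 11 exponent, high bit on top; 12-16 scratch; 17 oracle answer;
   18 nonempty as soon as a test has failed. *)
Definition sMove i j := SWhile i (fun b => SPush j b).
Definition sClear i := SWhile i (fun _ => SSkip).
(** Popping reverses a stack, so the copy goes through register 16, whose second traversal restores
    the order and duplicates. *)
Definition sCopy i j := SSeq (sMove i 16) (SWhile 16 (fun b => SSeq (SPush i b) (SPush j b))).
Fixpoint sSeqs (l : seq scmd) : scmd :=
  match l with [::] => SSkip | [:: c] => c | c :: l' => SSeq c (sSeqs l') end.

Lemma put_ext (r1 r2 : regs) : size r1 = size r2 -> (forall l, get r1 l = get r2 l) -> r1 = r2.
Proof. by move=> s12 g12; apply: (@eq_from_nth _ [::]) => // l _. Qed.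

Ltac eqs := repeat (match goal with |- context [@eq_op ?T ?a ?b] =>
    case: (@eqP T a b) => ? end; subst; try congruence; rewrite ?eqxx //=).

Ltac puts := apply: put_ext; [rewrite !size_set_nth; lia
  | move=> ?; do ?[rewrite nth_set_nth /=]; eqs].

Section Programs.
Variables (O : nat -> nat) (ok : pred nat).
Notation sev := (sev O ok).

Lemma sev_le c r r' n m : sev c r r' n -> n <= m -> sev c r r' m.
Proof.
case=> [r0 n0 n00|i b r0 n0 ir n00|i r0 n0 ir okq n00|a b r0 r1 r2 n1 n2 n0 s1 s2 le
  |i f r0 r1 n1 n0 ir s1 lt|i f r0 n0 ir rd n00|i f b s r0 r1 r2 n1 n2 n0 ir sE s1 s2 lt] nm.
- by apply: SevSkip; lia.
- by apply: SevPush => //; lia.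
- by apply: SevQry => //; lia.
- by apply: SevSeq s1 s2 _; lia.
- by apply: SevCase s1 _ => //; lia.
- by apply: SevWhileEnd => //; lia.
- by apply: SevWhileStep sE s1 s2 _ => //; lia.
Qed.

Lemma sev_seq a b r r1 r2 n1 n2 : sev a r r1 n1 -> sev b r1 r2 n2 -> sev (SSeq a b) r r2 (n1 + n2).
Proof. by move=> s1 s2; apply: SevSeq s1 s2 _. Qed.

Lemma sev_clear i (r : regs) : i < size r -> sev (sClear i) r (put r i [::]) (2 * size (get r i)).+1.
Proof.
move: {-1}(get r i) (erefl (get r i)) => s; elim: s r => [|b s IH] r gE ir.
  have -> : put r i [::] = r by puts.
  exact: SevWhileEnd.
have -> : put r i [::] = put (put r i s) i [::] by puts.
apply: (SevWhileStep ir gE (n1 := 1) (SevSkip _ _ _ _)) => //.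
  apply: IH; rewrite ?nth_set_nth /= ?eqxx // size_set_nth; lia.
by rewrite /=; lia.
Qed.

Lemma sev_move (i j : nat) (r : regs) : i != j -> i < size r -> j < size r ->
  sev (sMove i j) r (put (put r j (catrev (get r i) (get r j))) i [::]) (2 * size (get r i)).+1.
Proof.
move=> /eqP ij; move: {-1}(get r i) (erefl (get r i)) => s; elim: s r => [|b s IH] r gE ir jr.
  have -> : put (put r j (catrev [::] (get r j))) i [::] = r by puts.
  exact: SevWhileEnd.
pose r1 := put (put r i s) j (b :: get r j).
have -> : put (put r j (catrev (b :: s) (get r j))) i [::]
        = put (put r1 j (catrev s (get r1 j))) i [::].
  by rewrite /r1; puts.
have j1 : j < size (put r i s) by rewrite size_set_nth; lia.
have gj : get (put r i s) j = get r j by rewrite nth_set_nth /=; case: eqP => // e; case: ij.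
have e1 := SevPush O ok b j1 (leqnn 1); rewrite gj -/r1 in e1.
apply: (SevWhileStep ir gE e1 (IH _ _ _ _)); rewrite /r1 ?size_set_nth; try lia.
- by do ?[rewrite nth_set_nth /=]; eqs.
- by rewrite /=; lia.
Qed.

Lemma sev_copy (i j : nat) (r : regs) : i != j -> i != 16 -> j != 16 ->
  i < size r -> j < size r -> 16 < size r ->
  get r 16 = [::] -> sev (sCopy i j) r (put r j (get r i ++ get r j)) (5 * size (get r i) + 2).
Proof.
move=> ij i16 j16 ir jr r16 m0.
have e1 := sev_move i16 ir r16; rewrite m0 catrevE cats0 in e1.
have loop s (r0 : regs) : get r0 16 = s -> size r0 = size r ->
    sev (SWhile 16 (fun b => SSeq (SPush i b) (SPush j b))) r0
      (put (put (put r0 16 [::]) i (catrev s (get r0 i))) j (catrev s (get r0 j))) (3 * size s).+1.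
  elim: s r0 => [|b s IH] r0 gE sr.
    have -> : put (put (put r0 16 [::]) i (catrev [::] (get r0 i))) j (catrev [::] (get r0 j)) = r0.
      by rewrite /=; puts.
    by apply: SevWhileEnd; rewrite ?sr.
  pose r1 := put r0 16 s.
  pose r2 := put r1 i (b :: get r1 i).
  pose r3 := put r2 j (b :: get r2 j).
  have h1 : i < size r1 by rewrite /r1 size_set_nth; lia.
  have h2 : j < size r2 by rewrite /r2 /r1 !size_set_nth; lia.
  have e2 : sev (SPush i b) r1 r2 1 by apply: SevPush.
  have e3 : sev (SPush j b) r2 r3 1 by apply: SevPush.
  have g16 : get r3 16 = s.
    by rewrite /r3 /r2 /r1; do ?[rewrite nth_set_nth /=]; rewrite eq_sym (negbTE j16) eq_sym (negbTE i16).
  have s3 : size r3 = size r by rewrite /r3 /r2 /r1 !size_set_nth; lia.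
  have := IH r3 g16 s3.
  have -> : put (put (put r3 16 [::]) i (catrev s (get r3 i))) j (catrev s (get r3 j))
     = put (put (put r0 16 [::]) i (catrev (b :: s) (get r0 i))) j (catrev (b :: s) (get r0 j)).
    move: ij i16 j16; rewrite /r3 /r2 /r1 => /eqP ij /eqP i16 /eqP j16.
    apply: put_ext; first by rewrite !size_set_nth; lia.
    by clear -ij i16 j16; move=> l; do ?[rewrite nth_set_nth /=]; eqs.
  move=> e4.
  apply: (SevWhileStep (b := b) (s := s) _ gE (sev_seq e2 e3) e4); first by rewrite sr.
  by rewrite /=; lia.
pose r0 := put (put r 16 (rev (get r i))) i [::].
have g16 : get r0 16 = rev (get r i).
  by rewrite /r0; do ?[rewrite nth_set_nth /=]; rewrite eq_sym (negbTE i16).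
have s0 : size r0 = size r by rewrite /r0 !size_set_nth; lia.
have e2 := loop _ r0 g16 s0.
rewrite size_rev !catrevE revK in e2.
have -> : put r j (get r i ++ get r j)
   = put (put (put r0 16 [::]) i (get r i ++ get r0 i)) j (get r i ++ get r0 j).
  rewrite /r0; move: ij i16 j16 => /eqP ij /eqP i16 /eqP j16.
  apply: put_ext; first by rewrite !size_set_nth; lia.
  by clear -ij i16 j16 m0; move=> l; do ?[rewrite nth_set_nth /=]; eqs; rewrite ?cats0 ?m0.
apply: (SevSeq e1 e2); lia.
Qed.

End Programs.

(** * Programs for arithmetic modulo [p] *)

Ltac step H := eapply sev_seq; [eapply H; done | simpl].

(* Computes [x + y] and [x + y - p] in parallel, with the carry of the former in
   register 14 and the borrow of the latter in register 15. *)
Definition add_body (bp : bool) : scmd :=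
  SSeq (SPush 16 bp) (SCase 8 (fun ox => SCase 9 (fun oy => SCase 14 (fun oc => SCase 15 (fun ow =>
    let bx := bit_of ox in let by_ := bit_of oy in let c := bit_of oc in let w := bit_of ow in
    let sb := bx (+) by_ (+) c in
    SSeq (SPush 12 sb) (SSeq (SPush 14 (bx && by_ || c && (bx || by_)))
      (SSeq (SPush 13 (sb (+) bp (+) w)) (SPush 15 (~~ sb && (bp || w) || bp && w))))))))).

(** The sum is kept if subtracting [p] borrows while the addition did not carry, and the difference
    otherwise. The loop is driven by the bits of [p], restored from register 16. *)
Definition sAdd : scmd :=
  sSeqs [:: SPush 14 false; SPush 15 false; SWhile 0 add_body; sMove 16 0;
    SCase 14 (fun oc => SCase 15 (fun ow => if bit_of ow && ~~ bit_of oc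
      then SSeq (sMove 12 8) (sClear 13) else SSeq (sMove 13 8) (sClear 12)))].

Definition sub_body (bp : bool) : scmd :=
  SSeq (SPush 16 bp) (SCase 9 (fun oy => SCase 15 (fun ow =>
    let by_ := bit_of oy in let w := bit_of ow in
    SSeq (SPush 13 (bp (+) by_ (+) w)) (SPush 15 (~~ bp && (by_ || w) || by_ && w))))).

Definition sSub (j : nat) : scmd :=
  sSeqs [:: SPush 15 false; SWhile 0 sub_body; sMove 16 0; sClear 15; sMove 13 j].

(** Double-and-add. Moving register 8 to 10 puts the high bit on top and at the same time resets the
    accumulator to 0. *)
Definition sMul : scmd :=
  sSeqs [:: sMove 8 10;
    SWhile 10 (fun b => SSeq (sCopy 8 9) (SSeq sAdd (if b then SSeq (sCopy 7 9) sAdd else SSkip)));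
    sClear 7].

(** Square-and-multiply, from the high bit of the exponent down. *)
Definition sExp : scmd :=
  sSeqs [:: SPush 8 true;
    SWhile 11 (fun b => SSeq (sCopy 8 7) (SSeq sMul (if b then SSeq (sCopy 6 7) sMul else SSkip)));
    sClear 6].

Section Programs.
Variables (O : nat -> nat) (ok : pred nat).
Notation sev := (sev O ok).

Lemma sev_push i b (r : regs) : i < size r -> sev (SPush i b) r (put r i (b :: get r i)) 1.
Proof. by move=> ir; apply: SevPush. Qed.

Lemma sev_case i f (r r1 : regs) n : i < size r ->
  sev (f (ohead (get r i))) (put r i (behead (get r i))) r1 n -> sev (SCase i f) r r1 n.+1.
Proof. by move=> ir e; apply: SevCase e _. Qed.

Lemma sev_while_end i f (r : regs) : i < size r -> get r i = [::] -> sev (SWhile i f) r r 1.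
Proof. by move=> ir e; apply: SevWhileEnd. Qed.

Lemma sev_while_step i f b s (r r1 r2 : regs) n1 n2 : i < size r -> get r i = b :: s ->
  sev (f b) (put r i s) r1 n1 -> sev (SWhile i f) r1 r2 n2 -> sev (SWhile i f) r r2 (n1 + n2).+1.
Proof. by move=> ir e e1 e2; apply: SevWhileStep e e1 e2 _. Qed.

Lemma add_loop (p e t u z k c a b n q v : seq bool) : forall x y (cf wf : bool) s d m,
  size x <= size p -> size y <= size p -> exists S D (c2 w2 : bool),
  [/\ size S = size p, size D = size p, nval S + 2 ^ size p * c2 = nval x + nval y + cf,
      nval D + nval p + wf = nval S + 2 ^ size p * w2 &
  sev (SWhile 0 add_body)
    [:: p; e; t; u; z; k; c; a; x; y; b; n; s; d; [:: cf]; [:: wf]; m; q; v]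
    [:: [::]; e; t; u; z; k; c; a; [::]; [::]; b; n; catrev S s; catrev D d; [:: c2]; [:: w2];
        catrev p m; q; v] (10 * size p).+1].
Proof.
elim: p => [|bp p IH] x y cf wf s d m xp yp.
  move: xp yp; case: x => // _; case: y => // _.
  exists [::], [::], cf, wf; split=> //=; try lia.
  exact: sev_while_end.
have xp' : size (behead x) <= size p by rewrite size_behead; move: xp => /=; lia.
have yp' : size (behead y) <= size p by rewrite size_behead; move: yp => /=; lia.
pose bx := hbit x; pose by_ := hbit y; pose sb := bx (+) by_ (+) cf.
have [S [D [c2 [w2 [sS sD vS vD e1]]]]] := IH (behead x) (behead y)
  (bx && by_ || cf && (bx || by_)) (~~ sb && (bp || wf) || bp && wf)
  (sb :: s) ((sb (+) bp (+) wf) :: d) (bp :: m) xp' yp'.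
exists (sb :: S), ((sb (+) bp (+) wf) :: D), c2, w2; split.
- by rewrite /= sS.
- by rewrite /= sD.
- rewrite (val_hd x) (val_hd y) val_cons [size _]/= expnS.
  clear -vS; move: vS; rewrite /sb /bx /by_.
  clear sb bx by_; by case: (hbit x); case: (hbit y); case: cf; case: c2 => /=; lia.
- rewrite !val_cons [size _]/= expnS; clearbody sb; clear -vD; move: vD.
  by case: sb; case: bp; case: wf; case: w2 => /=; lia.
- eapply sev_le.
    eapply sev_while_step; [done|reflexivity| |exact: e1].
    step sev_push. do 4 (eapply sev_case; [done|simpl]).
    rewrite -/(hbit x) -/(hbit y) -/bx -/by_ /bit_of /= -/sb.
    step sev_push. step sev_push. step sev_push. exact: sev_push.
  by rewrite /=; lia.
Qed.

(** [Q] is the power of two at which the words are cut, [c2] the carry and [w2] the borrow. Since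
    [X + Y < 2 * P], a carry forces a borrow; hence [X + Y < P] exactly for a borrow without carry,
    and otherwise [D = X + Y - P]. *)
Lemma mod_select (P X Y S D c2 w2 Q : nat) : P < Q -> S < Q -> D < Q -> X + Y < 2 * P ->
  c2 <= 1 -> w2 <= 1 -> S + Q * c2 = X + Y -> D + P = S + Q * w2 ->
  (X + Y) %% P = if (w2 == 1) && (c2 == 0) then S else D.
Proof.
move=> PQ SQ DQ XY c2b w2b vS vD.
have modE : (X + Y) %% P = if X + Y < P then X + Y else X + Y - P.
  have [XP|PX] := ltnP (X + Y) P; first by rewrite modn_small.
  by rewrite -[X in X %% _](subnK PX) modnDr modn_small; lia.
rewrite modE.
by case: c2 c2b vS => [|[|//]] _ vS; case: w2 w2b vD => [|[|//]] _ vD /=; rewrite ?muln0 ?muln1 in vS vD;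
  case: ifP; lia.
Qed.

Lemma add_ok (p e t u z k c a x y b n q v : seq bool) :
  size x <= size p -> size y <= size p -> nval x + nval y < 2 * nval p -> exists x',
  [/\ size x' = size p, nval x' = (nval x + nval y) %% nval p &
  sev sAdd [:: p; e; t; u; z; k; c; a; x; y; b; n; [::]; [::]; [::]; [::]; [::]; q; v]
    [:: p; e; t; u; z; k; c; a; x'; [::]; b; n; [::]; [::]; [::]; [::]; [::]; q; v]
    (20 * (size p).+1)].
Proof.
move=> xp yp xy.
have [S [D [c2 [w2 [sS sD vS vD e1]]]]] := add_loop e t u z k c a b n q v false false [::] [::] [::] xp yp.
exists (if w2 && ~~ c2 then S else D); split.
- by case: ifP.
- rewrite (@mod_select (nval p) (nval x) (nval y) (nval S) (nval D) c2 w2 (2 ^ size p)) //.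
  + by case: (w2); case: (c2).
  + exact: val_lt.
  + by rewrite -sS val_lt.
  + by rewrite -sD val_lt.
  + by case: (c2).
  + by case: (w2).
  + by rewrite vS addn0.
  + by rewrite -vD addn0.
eapply sev_le.
  rewrite /sAdd /sSeqs.
  step sev_push. step sev_push.
  eapply sev_seq; [exact: e1|simpl].
  step sev_move. rewrite !catrevE !cats0 revK.
  do 2 (eapply sev_case; [done|simpl]); rewrite /bit_of /=.
  (* A common time bound for the two branches of the selection. *)
  instantiate (1 := (4 * size p).+2).
  case: ifP => _; (eapply sev_le; [eapply sev_seq; [eapply sev_move; done|
      simpl; rewrite !catrevE !cats0 revK; eapply sev_clear; done]|]);
    by rewrite /= ?size_rev ?catrevE ?cats0 ?revK ?size_rev; lia.
by rewrite /= ?catrevE ?cats0 ?size_rev; lia.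
Qed.

Lemma sub_loop (p e t u z k c a x b n s q v : seq bool) : forall y (wf : bool) d m,
  size y <= size p -> exists D (w2 : bool),
  [/\ size D = size p, nval D + nval y + wf = nval p + 2 ^ size p * w2 &
  sev (SWhile 0 sub_body)
    [:: p; e; t; u; z; k; c; a; x; y; b; n; s; d; [::]; [:: wf]; m; q; v]
    [:: [::]; e; t; u; z; k; c; a; x; [::]; b; n; s; catrev D d; [::]; [:: w2];
        catrev p m; q; v] (6 * size p).+1].
Proof.
elim: p => [|bp p IH] y wf d m yp.
  move: yp; case: y => // _.
  exists [::], wf; split=> //=; first by lia.
  exact: sev_while_end.
have yp' : size (behead y) <= size p by rewrite size_behead; move: yp => /=; lia.
pose by_ := hbit y.
have [D [w2 [sD vD e1]]] := IH (behead y) (~~ bp && (by_ || wf) || by_ && wf)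
  ((bp (+) by_ (+) wf) :: d) (bp :: m) yp'.
exists ((bp (+) by_ (+) wf) :: D), w2; split.
- by rewrite /= sD.
- rewrite (val_hd y) !val_cons [size _]/= expnS; clear -vD; move: vD.
  by rewrite -/by_; clearbody by_; case: by_; case: bp; case: wf; case: w2 => /=; lia.
- eapply sev_le.
    eapply sev_while_step; [done|reflexivity| |exact: e1].
    step sev_push. do 2 (eapply sev_case; [done|simpl]).
    rewrite -/(hbit y) -/by_ /bit_of /=.
    step sev_push. exact: sev_push.
  by rewrite /=; lia.
Qed.

(** The target [j] is a parameter because the program serves for [p - 2] in register 5 and for
    [p - t] in register 2. *)
Lemma sub_ok (j : nat) (p e t u z k c a x y b n q v : seq bool) :
  13 != j -> j < 19 -> size y <= size p -> nval y <= nval p -> exists D,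
  [/\ size D = size p, nval D = nval p - nval y &
  sev (sSub j) [:: p; e; t; u; z; k; c; a; x; y; b; n; [::]; [::]; [::]; [::]; [::]; q; v]
    (put (put [:: p; e; t; u; z; k; c; a; x; [::]; b; n; [::]; rev D; [::]; [::]; [::]; q; v] j
      (catrev (rev D) (get [:: p; e; t; u; z; k; c; a; x; [::]; b; n; [::]; rev D; [::]; [::]; [::]; q; v] j)))
      13 [::])
    (20 * (size p).+1)].
Proof.
move=> j13 j19 yp ypv.
have [D [w2 [sD vD e1]]] := sub_loop e t u z k c a x b n [::] q v false [::] [::] yp.
exists D; split=> //.
  move: vD ypv; rewrite addn0; have := val_lt D; rewrite sD; have := val_lt p.
  by case: w2 {e1} => /=; rewrite ?muln0 ?muln1; lia.
eapply sev_le.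
  rewrite /sSub /sSeqs.
  step sev_push.
  eapply sev_seq; [exact: e1|simpl].
  step sev_move. rewrite !catrevE !cats0 revK.
  step sev_clear. rewrite -(catrevE (rev D)).
  exact: sev_move.
by rewrite /= ?size_rev ?catrevE ?cats0 ?size_rev; lia.
Qed.

(** The accumulator of double-and-add before any reduction, the bits being read from the high
    end. *)
Definition horner2 (a : nat) (x : nat) (b : seq bool) : nat :=
  foldl (fun acc (b : bool) => 2 * acc + b * a) x b.

Lemma horner2_val a s : horner2 a 0 (rev s) = nval s * a.
Proof.
rewrite /horner2 foldl_rev; elim: s => //= b s ->.
by rewrite -mul2n mulnDl mulnA addnC.
Qed.

Lemma horner2_mod a m x y b : x = y %[mod m] -> horner2 a x b = horner2 a y b %[mod m].
Proof.
elim: b x y => //= c b IH x y xy; apply: IH.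
by rewrite -(modnDml (2 * x)) -(modnMmr 2 x) xy modnMmr modnDml.
Qed.

Lemma mul_loop (p e t u z k c a n q v : seq bool) : size a <= size p -> nval a < nval p ->
  forall b x, size x <= size p -> nval x < nval p -> exists x',
  [/\ size x' <= size p, nval x' < nval p, nval x' = horner2 (nval a) (nval x) b %% nval p &
  sev (SWhile 10 (fun b => SSeq (sCopy 8 9) (SSeq sAdd (if b then SSeq (sCopy 7 9) sAdd else SSkip))))
    [:: p; e; t; u; z; k; c; a; x; [::]; b; n; [::]; [::]; [::]; [::]; [::]; q; v]
    [:: p; e; t; u; z; k; c; a; x'; [::]; [::]; n; [::]; [::]; [::]; [::]; [::]; q; v]
    (55 * (size p).+1 * size b).+1].
Proof.
move=> ap av; elim=> [|b s IH] x xp xv.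
  exists x; split=> //; first by rewrite modn_small.
  by rewrite muln0; exact: sev_while_end.
have p0 : 0 < nval p by lia.
have [x1 [sx1 vx1 e1]] := @add_ok p e t u z k c a x x s n q v xp xp ltac:(lia).
have vx1p : nval x1 < nval p by rewrite vx1 ltn_mod.
have [x2 [sx2 vx2p vx2 e2]] : exists x2, [/\ size x2 <= size p, nval x2 < nval p,
    nval x2 = (2 * nval x + b * nval a) %% nval p &
    sev (if b then SSeq (sCopy 7 9) sAdd else SSkip)
     [:: p; e; t; u; z; k; c; a; x1; [::]; s; n; [::]; [::]; [::]; [::]; [::]; q; v]
     [:: p; e; t; u; z; k; c; a; x2; [::]; s; n; [::]; [::]; [::]; [::]; [::]; q; v]
     (25 * (size p).+1 + 2)].
  case: b; last first.
    exists x1; split=> //; rewrite ?sx1 ?addn0 ?mul2n -?addnn //.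
    by apply: SevSkip; lia.
  have x1p : size x1 <= size p by rewrite sx1.
  have [x2 [sx2 vx2 e2]] := @add_ok p e t u z k c a x1 a s n q v x1p ap ltac:(lia).
  exists x2; split; rewrite ?sx2 ?vx2 ?ltn_mod //.
    by rewrite vx1 modnDml mul2n addnn mul1n.
  eapply sev_le.
    step sev_copy. rewrite cats0. exact: e2.
  by rewrite /=; lia.
have [x' [sx' vx'p vx' e3]] := IH x2 sx2 vx2p.
exists x'; split=> //.
  by rewrite vx' /=; apply: horner2_mod; rewrite vx2 modn_mod.
eapply sev_le.
  eapply sev_while_step; [done|reflexivity| |exact: e3].
  step sev_copy. rewrite cats0.
  eapply sev_seq; [exact: e1|exact: e2].
rewrite /= mulnS; lia.
Qed.

Lemma mul_ok (p e t u z k c a x n q v : seq bool) : size a <= size p -> nval a < nval p ->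
  size x <= size p -> exists x',
  [/\ size x' <= size p, nval x' < nval p, nval x' = (nval x * nval a) %% nval p &
  sev sMul
    [:: p; e; t; u; z; k; c; a; x; [::]; [::]; n; [::]; [::]; [::]; [::]; [::]; q; v]
    [:: p; e; t; u; z; k; c; [::]; x'; [::]; [::]; n; [::]; [::]; [::]; [::]; [::]; q; v]
    (60 * ((size p).+1 * (size p).+1))].
Proof.
move=> ap av xp.
have [x' [sx' vx'p vx' e1]] := @mul_loop p e t u z k c a n q v ap av (rev x) [::] (leq0n _) ltac:(simpl; lia).
exists x'; split=> //; first by rewrite vx' horner2_val.
eapply sev_le.
  rewrite /sMul /sSeqs.
  step sev_move. rewrite catrevE cats0.
  eapply sev_seq; [exact: e1|simpl].
  exact: sev_clear.
rewrite /= size_rev; nia.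
Qed.

Definition exp2 (c : nat) (x : nat) (b : seq bool) : nat :=
  foldl (fun acc (b : bool) => acc * acc * c ^ b) x b.

Lemma exp2_val c s : exp2 c 1 (rev s) = c ^ nval s.
Proof.
rewrite /exp2 foldl_rev; elim: s => //= b s ->.
by rewrite -expnD addnn -expnD addnC.
Qed.

Lemma exp2_mod c m x y b : x = y %[mod m] -> exp2 c x b = exp2 c y b %[mod m].
Proof.
elim: b x y => //= d b IH x y xy; apply: IH.
by rewrite -(modnMml (x * x)) -(modnMm x) xy modnMm modnMml.
Qed.

Lemma exp_loop (p e t u z k c q v : seq bool) : size c <= size p -> nval c < nval p ->
  forall n x, size x <= size p -> nval x < nval p -> exists x',
  [/\ size x' <= size p, nval x' < nval p, nval x' = exp2 (nval c) (nval x) n %% nval p &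
  sev (SWhile 11 (fun b => SSeq (sCopy 8 7) (SSeq sMul (if b then SSeq (sCopy 6 7) sMul else SSkip))))
    [:: p; e; t; u; z; k; c; [::]; x; [::]; [::]; n; [::]; [::]; [::]; [::]; [::]; q; v]
    [:: p; e; t; u; z; k; c; [::]; x'; [::]; [::]; [::]; [::]; [::]; [::]; [::]; [::]; q; v]
    (140 * ((size p).+1 * (size p).+1) * size n).+1].
Proof.
move=> cp cv; elim=> [|b s IH] x xp xv.
  exists x; split=> //; first by rewrite modn_small.
  by rewrite muln0; exact: sev_while_end.
have p0 : 0 < nval p by lia.
have [x1 [sx1 vx1p vx1 e1]] := @mul_ok p e t u z k c x x s q v xp xv xp.
have [x2 [sx2 vx2p vx2 e2]] : exists x2, [/\ size x2 <= size p, nval x2 < nval p,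
    nval x2 = (nval x * nval x * nval c ^ b) %% nval p &
    sev (if b then SSeq (sCopy 6 7) sMul else SSkip)
     [:: p; e; t; u; z; k; c; [::]; x1; [::]; [::]; s; [::]; [::]; [::]; [::]; [::]; q; v]
     [:: p; e; t; u; z; k; c; [::]; x2; [::]; [::]; s; [::]; [::]; [::]; [::]; [::]; q; v]
     (65 * ((size p).+1 * (size p).+1) + 2)].
  case: b; last first.
    exists x1; split=> //; first by rewrite expn0 muln1.
    by apply: SevSkip; lia.
  have [x2 [sx2 vx2p vx2 e2]] := @mul_ok p e t u z k c c x1 s q v cp cv sx1.
  exists x2; split=> //.
    by rewrite vx2 vx1 expn1 modnMml.
  eapply sev_le.
    step sev_copy. rewrite cats0. exact: e2.
  by rewrite /=; nia.
have [x' [sx' vx'p vx' e3]] := IH x2 sx2 vx2p.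
exists x'; split=> //.
  by rewrite vx' /=; apply: exp2_mod; rewrite vx2 modn_mod.
eapply sev_le.
  eapply sev_while_step; [done|reflexivity| |exact: e3].
  step sev_copy. rewrite cats0.
  eapply sev_seq; [exact: e1|exact: e2].
rewrite /= mulnS; nia.
Qed.

Lemma exp_ok (p e t u z k c n q v : seq bool) : size c <= size p -> nval c < nval p ->
  1 < nval p -> size n <= size p -> exists x',
  [/\ size x' <= size p, nval x' < nval p, nval x' = (nval c ^ nval n) %% nval p &
  sev sExp
    [:: p; e; t; u; z; k; c; [::]; [::]; [::]; [::]; rev n; [::]; [::]; [::]; [::]; [::]; q; v]
    [:: p; e; t; u; z; k; [::]; [::]; x'; [::]; [::]; [::]; [::]; [::]; [::]; [::]; [::]; q; v]
    (150 * ((size p).+1 * (size p).+1 * (size p).+1))].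
Proof.
move=> cp cv p1 np.
have sp1 : size [:: true] <= size p by have := val_lt p; case: (size p) => //; rewrite expn0; lia.
have [x' [sx' vx'p vx' e1]] := @exp_loop p e t u z k c q v cp cv (rev n) [:: true] sp1 p1.
exists x'; split=> //; first by rewrite vx' exp2_val.
eapply sev_le.
  rewrite /sExp /sSeqs.
  step sev_push.
  eapply sev_seq; [exact: e1|simpl].
  exact: sev_clear.
rewrite /= size_rev; nia.
Qed.

End Programs.

(** * The decision program on stacks *)

(** A test for a nonzero value: [j] receives one entry for each bit 1 of [i]. *)
Definition sMark (i j : nat) : scmd := SWhile i (fun b => if b then SPush j true else SSkip).

(** Compares values rather than words, since computed residues may have zeros at the high end while
    oracle answers have none; bits remaining in the answer must all be 0. *)
Definition sCompare : scmd :=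
  SSeq (SWhile 8 (fun b => SCase 17 (fun o => if b == bit_of o then SSkip else SPush 18 true)))
    (sMark 17 18).

(** The exponent passes through register 12 so that its copy arrives in 11 reversed, high bit on
    top. *)
Definition sTest : scmd :=
  sSeqs [:: sClear 12; sCopy 8 6; sCopy 2 9; sAdd; SQry 8; sCopy 8 17; sClear 8;
    sCopy 1 12; sMove 12 11; sExp; sCompare].

(** Scanning destroys its operand, so a copy of the power is scanned; register 12 stays empty
    exactly when that power is 0, and then no query is made. *)
Definition sBody : scmd :=
  sSeqs [:: sCopy 4 8; sClear 4; SPush 9 true; sAdd; sCopy 8 4; sCopy 8 6; sClear 8;
    sCopy 5 12; sMove 12 11; sExp; sCopy 8 9; sMark 9 12;
    SCase 12 (fun o => if o is None then sClear 8 else sTest)].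

(* The counter gets length [K * 2 ^ ceil (len e / m)]: it is doubled once for every
   block of [m] bits of [e]. *)
Definition sInit (K m : nat) : scmd :=
  sSeqs [:: iter K (SSeq (SPush 3 true)) SSkip; sCopy 1 11;
    SWhile 11 (fun _ => SSeq (iter m.-1 (fun c => SCase 11 (fun _ => c)) SSkip)
      (SSeq (SWhile 3 (fun b => SSeq (SPush 12 b) (SPush 12 b))) (sMove 12 3)));
    SPush 9 true; SPush 9 false; sSub 5; sCopy 2 9; sClear 2; sSub 2].

Definition sMain (K m : nat) : scmd := SSeq (sInit K m) (SWhile 3 (fun _ => sBody)).

Section Programs.
Variables (O : nat -> nat) (ok : pred nat).
Notation sev := (sev O ok).

Lemma sev_skip (r : regs) : sev SSkip r r 1.
Proof. exact: SevSkip. Qed.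

Lemma sev_qry i (r : regs) : i < size r -> ok (nval (get r i)) ->
  sev (SQry i) r (put r i (bits_of (O (nval (get r i))))) 1.
Proof. by move=> ir okr; apply: SevQry. Qed.

Lemma mark_nonzero_scratch (p e t u z k c a x b n q v : seq bool) y d : exists d',
  [/\ (d' == [::]) = (d == [::]) && (nval y == 0), size d' <= size y + size d &
  sev (sMark 9 12)
    [:: p; e; t; u; z; k; c; a; x; y; b; n; d; [::]; [::]; [::]; [::]; q; v]
    [:: p; e; t; u; z; k; c; a; x; [::]; b; n; d'; [::]; [::]; [::]; [::]; q; v]
    (2 * size y).+1].
Proof.
elim: y d => [|h y IH] d.
  by exists d; split; rewrite ?andbT //; apply: sev_while_end.
have [d' [dE sd e1]] := IH (if h then true :: d else d).
exists d'; split.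
- by rewrite dE val_cons; case: (h) => //=; rewrite ?andbF // add0n muln_eq0.
- by apply: leq_trans sd _; case: (h) => /=; lia.
- eapply sev_le.
    eapply sev_while_step; [done|reflexivity| |exact: e1].
    by instantiate (1 := 1); case: (h); [exact: sev_push|exact: sev_skip].
  by rewrite /=; lia.
Qed.

Lemma mark_nonzero_answer (p e t u z k c a x y b n d : seq bool) q v : exists v',
  (v' == [::]) = (v == [::]) && (nval q == 0) /\
  sev (sMark 17 18)
    [:: p; e; t; u; z; k; c; a; x; y; b; n; d; [::]; [::]; [::]; [::]; q; v]
    [:: p; e; t; u; z; k; c; a; x; y; b; n; d; [::]; [::]; [::]; [::]; [::]; v']
    (2 * size q).+1.
Proof.
elim: q v => [|h q IH] v.
  by exists v; split; rewrite ?andbT //; apply: sev_while_end.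
have [d' [dE e1]] := IH (if h then true :: v else v).
exists d'; split.
- by rewrite dE val_cons; case: (h) => //=; rewrite ?andbF // add0n muln_eq0.
- eapply sev_le.
    eapply sev_while_step; [done|reflexivity| |exact: e1].
    by instantiate (1 := 1); case: (h); [exact: sev_push|exact: sev_skip].
  by rewrite /=; lia.
Qed.

Lemma compare_ok (p e t u z k c a y b n d : seq bool) x q v : exists v',
  (v' == [::]) = (v == [::]) && (nval x == nval q) /\
  sev sCompare
    [:: p; e; t; u; z; k; c; a; x; y; b; n; d; [::]; [::]; [::]; [::]; q; v]
    [:: p; e; t; u; z; k; c; a; [::]; y; b; n; d; [::]; [::]; [::]; [::]; [::]; v']
    (3 * size x + 2 * size q + 2).
Proof.
suff [q' [v' [vE sq e1]]] : exists q' v', [/\ (v' == [::]) && (nval q' == 0) = (v == [::]) && (nval x == nval q),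
    size q' <= size q &
  sev (SWhile 8 (fun b => SCase 17 (fun o => if b == bit_of o then SSkip else SPush 18 true)))
    [:: p; e; t; u; z; k; c; a; x; y; b; n; d; [::]; [::]; [::]; [::]; q; v]
    [:: p; e; t; u; z; k; c; a; [::]; y; b; n; d; [::]; [::]; [::]; [::]; q'; v']
    (3 * size x).+1].
  have [v2 [v2E e2]] := mark_nonzero_answer p e t u z k c a [::] y b n d q' v'.
  exists v2; split; first by rewrite v2E vE.
  by eapply sev_le; [eapply sev_seq; [exact: e1|exact: e2]|lia].
elim: x q v => [|h x IH] q v.
  by exists q, v; split; rewrite // ?[_ == nval q]eq_sym //; apply: sev_while_end.
have [q' [v' [vE sq e1]]] := IH (behead q) (if h == hbit q then v else true :: v).
exists q', v'; split.
- rewrite vE (val_hd q) val_cons.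
  have -> : (h + 2 * nval x == hbit q + 2 * nval (behead q)) = (h == hbit q) && (nval x == nval (behead q)).
    by case: (h); case: (hbit q); rewrite /= ?eqn_add2l ?eqn_pmul2l //; apply/negbTE/eqP; lia.
  by case: (h == hbit q) => /=; rewrite ?andbF.
- by apply: leq_trans sq _; rewrite size_behead leq_pred.
- eapply sev_le.
    eapply sev_while_step; [done|reflexivity| |exact: e1].
    eapply sev_case; [done|simpl]; rewrite -/(hbit q).
    by instantiate (1 := 1); case: eqP => _; [exact: sev_skip|exact: sev_push].
  by rewrite /=; lia.
Qed.

(* The exponent [P - 2] inverts [z]; for [x = 0] the query would be the forbidden one. *)
Definition passes (P e t z : nat) : bool :=
  let x := z ^ (P - 2) %% P in (x == 0) || (O ((x + t) %% P) == x ^ e %% P).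

Section Loop.
(** Here [t] is the content of register 2 after initialisation, the negative mod [p] of the known
    element; [k] holds the exponent [p - 2]. *)
Variables (p e t k : seq bool).
Notation P := (nval p).
Notation L := (size p).+1.
Hypothesis P1 : 1 < P.
Hypothesis OP : forall x, O x < P.
Hypothesis okP : forall x, 0 < x < P -> ok ((x + nval t) %% P).
Hypotheses (ep : size e <= size p) (tp : size t <= size p) (kp : size k <= size p).
Hypotheses (tP : nval t <= P) (kE : nval k = P - 2).

Lemma test_ok (u z x v d : seq bool) : size d <= size p -> size x <= size p -> 0 < nval x < P ->
  exists v', (v' == [::]) = (v == [::]) && (O ((nval x + nval t) %% P) == nval x ^ nval e %% P) /\
  sev sTest
    [:: p; e; t; u; z; k; [::]; [::]; x; [::]; [::]; [::]; d; [::]; [::]; [::]; [::]; [::]; v]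
    [:: p; e; t; u; z; k; [::]; [::]; [::]; [::]; [::]; [::]; [::]; [::]; [::]; [::]; [::]; [::]; v']
    (300 * (L * L * L)).
Proof.
move=> dp xp /andP[x0 xP].
have [x1 [sx1 vx1 e1]] := @add_ok O ok p e t u z k x [::] x t [::] [::] [::] v xp tp ltac:(lia).
pose y := bits_of (O (nval x1)).
have yp : size y <= size p by apply: size_bits_of; apply: ltn_trans (OP _) (val_lt p).
have [x2 [sx2 x2P vx2 e2]] := @exp_ok O ok p e t u z k x e y v xp xP P1 ep.
have [v' [vE e3]] := compare_ok p e t u z k [::] [::] [::] [::] [::] [::] x2 y v.
exists v'; split.
  by rewrite vE vx2 /y bits_of_val vx1; congr (_ && _); rewrite eq_sym.
eapply sev_le.
  rewrite /sTest /sSeqs.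
  step sev_clear. step sev_copy. step sev_copy. rewrite !cats0.
  eapply sev_seq; [exact: e1|].
  eapply sev_seq; [eapply sev_qry; [done|by rewrite /= vx1; apply: okP; rewrite x0]|simpl].
  rewrite -/y. step sev_copy. step sev_clear. step sev_copy. step sev_move.
  rewrite !cats0 catrevE cats0.
  eapply sev_seq; [exact: e2|exact: e3].
rewrite /= !cats0.
have h1 : L <= L * L by rewrite leq_pmulr.
have h2 : L * L <= L * L * L by rewrite leq_pmulr.
move: (L * L * L) h2 => L3 h2; lia.
Qed.

Lemma body_ok (u z v : seq bool) : size z <= size p -> nval z < P -> exists z' v',
  [/\ size z' <= size p, nval z' = (nval z + 1) %% P,
     (v' == [::]) = (v == [::]) && passes P (nval e) (nval t) (nval z') &
  sev sBody
    [:: p; e; t; u; z; k; [::]; [::]; [::]; [::]; [::]; [::]; [::]; [::]; [::]; [::]; [::]; [::]; v]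
    [:: p; e; t; u; z'; k; [::]; [::]; [::]; [::]; [::]; [::]; [::]; [::]; [::]; [::]; [::]; [::]; v']
    (600 * (L * L * L))].
Proof.
move=> zp zP.
have p1 : size [:: true] <= size p by have := val_lt p; case: (size p) => //; rewrite expn0; lia.
have [z1 [sz1 vz1 e1]] := @add_ok O ok p e t u [::] k [::] [::] z [:: true] [::] [::] [::] v zp p1
  ltac:(simpl; lia).
have z1p : size z1 <= size p by rewrite sz1.
have z1P : nval z1 < P by rewrite vz1 ltn_mod; lia.
have [x [sx xP vx e2]] := @exp_ok O ok p e t u z1 k z1 k [::] v z1p z1P P1 kp.
have [d [dE sd e3]] := mark_nonzero_scratch p e t u z1 k [::] [::] x [::] [::] [::] v x [::].
have [v' [vE e4]] : exists v', (v' == [::]) = (v == [::]) && passes P (nval e) (nval t) (nval z1) /\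
  sev (SCase 12 (fun o => if o is None then sClear 8 else sTest))
    [:: p; e; t; u; z1; k; [::]; [::]; x; [::]; [::]; [::]; d; [::]; [::]; [::]; [::]; [::]; v]
    [:: p; e; t; u; z1; k; [::]; [::]; [::]; [::]; [::]; [::]; [::]; [::]; [::]; [::]; [::]; [::]; v']
    (310 * (L * L * L)).
  have h1 : L <= L * L by rewrite leq_pmulr.
  have h2 : L * L <= L * L * L by rewrite leq_pmulr.
  case: d dE sd {e3} => [|h d] /= dE sd.
    exists v; split; first by rewrite /passes -kE -vx -dE andbT.
    eapply sev_le; first by eapply sev_case; [done|simpl; exact: sev_clear].
    by rewrite /=; lia.
  have dp : size d <= size p by apply: leq_trans sx; rewrite addn0 in sd; apply: ltnW.
  have x0P : 0 < nval x < P by rewrite xP lt0n -dE.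
  have [v' [vE e4]] := test_ok u z1 v dp sx x0P.
  exists v'; split; first by rewrite vE /passes -kE -vx -dE.
  eapply sev_le; first by eapply sev_case; [done|simpl; exact: e4].
  by move: (L * L * L) h2 => L3 h2; lia.
exists z1, v'; split=> //.
eapply sev_le.
  rewrite /sBody /sSeqs.
  step sev_copy. step sev_clear. step sev_push. rewrite !cats0.
  eapply sev_seq; [exact: e1|].
  step sev_copy. step sev_copy. step sev_clear. step sev_copy. step sev_move.
  rewrite !cats0 catrevE cats0.
  eapply sev_seq; [exact: e2|].
  step sev_copy. rewrite cats0.
  eapply sev_seq; [exact: e3|exact: e4].
rewrite /= !cats0.
have h1 : L <= L * L by rewrite leq_pmulr.
have h2 : L * L <= L * L * L by rewrite leq_pmulr.
move: (L * L * L) h2 => L3 h2; lia.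
Qed.

Lemma main_loop (u z v : seq bool) : size z <= size p -> nval z < P -> exists r',
  (get r' 18 == [::]) = (v == [::]) &&
     all (fun i => passes P (nval e) (nval t) ((nval z + i) %% P)) (iota 1 (size u)) /\
  sev (SWhile 3 (fun _ => sBody))
    [:: p; e; t; u; z; k; [::]; [::]; [::]; [::]; [::]; [::]; [::]; [::]; [::]; [::]; [::]; [::]; v]
    r' (601 * (L * L * L) * size u).+1.
Proof.
elim: u z v => [|h u IH] z v zp zP.
  by eexists; split; last (rewrite muln0; exact: sev_while_end); rewrite andbT.
have [z1 [v1 [sz1 vz1 v1E e1]]] := body_ok u v zp zP.
have z1P : nval z1 < P by rewrite vz1 ltn_mod; lia.
have [r' [rE e2]] := IH z1 v1 sz1 z1P.
exists r'; split.
  rewrite rE v1E -andbA /= vz1; congr (_ && (_ && _)).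
  rewrite (iotaDl 1 1) all_map; apply: eq_all => i /=.
  by rewrite modnDml addnA.
eapply sev_le; first by eapply sev_while_step; [done|reflexivity|exact: e1|exact: e2].
rewrite /= mulnS; move: (L * L * L * size u) (erefl (L * L * L * size u)); nia.
Qed.

End Loop.
Lemma init_push K (p e t u z k c a x y b n d : seq bool) :
  sev (iter K (SSeq (SPush 3 true)) SSkip)
    [:: p; e; t; u; z; k; c; a; x; y; b; n; d; [::]; [::]; [::]; [::]; [::]; [::]]
    [:: p; e; t; nseq K true ++ u; z; k; c; a; x; y; b; n; d; [::]; [::]; [::]; [::]; [::]; [::]] K.+1.
Proof.
elim: K u => [|K IH] u; first exact: sev_skip.
have -> : nseq K.+1 true ++ u = nseq K true ++ true :: u by elim: (K) => //= K' ->.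
by eapply sev_le; [step sev_push; exact: IH|].
Qed.

Lemma pops_ok i (p e t u z k c a x y b n d : seq bool) :
  sev (iter i (fun c => SCase 11 (fun _ => c)) SSkip)
    [:: p; e; t; u; z; k; c; a; x; y; b; n; d; [::]; [::]; [::]; [::]; [::]; [::]]
    [:: p; e; t; u; z; k; c; a; x; y; b; drop i n; d; [::]; [::]; [::]; [::]; [::]; [::]] i.+1.
Proof.
elim: i n => [|i IH] n; first by rewrite drop0; exact: sev_skip.
have -> : drop i.+1 n = drop i (behead n) by case: n.
by apply: sev_case => //=; apply: IH.
Qed.

Lemma double_ok (p e t u z k c a x y b n : seq bool) d : exists d',
  size d' = 2 * size u + size d /\
  sev (SWhile 3 (fun b => SSeq (SPush 12 b) (SPush 12 b)))
    [:: p; e; t; u; z; k; c; a; x; y; b; n; d; [::]; [::]; [::]; [::]; [::]; [::]]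
    [:: p; e; t; [::]; z; k; c; a; x; y; b; n; d'; [::]; [::]; [::]; [::]; [::]; [::]] (3 * size u).+1.
Proof.
elim: u d => [|h u IH] d; first by exists d; split=> //; exact: sev_while_end.
have [d' [sd e1]] := IH (h :: h :: d).
exists d'; split; first by rewrite sd /=; lia.
eapply sev_le.
  eapply sev_while_step; [done|reflexivity| |exact: e1].
  step sev_push. exact: sev_push.
by rewrite /=; lia.
Qed.

(** A round consumes [m] bits, one by the loop and [m.-1] by the body, where pops of an empty stack
    do no harm: hence the rounded-up quotient and the induction on length. Since the counter only
    grows, its final size bounds the cost of every round. *)
Lemma init_loop m (p e t z k c a x y b : seq bool) : 0 < m -> forall n u, exists u',
  size u' = size u * 2 ^ ((size n + m.-1) %/ m) /\
  sev (SWhile 11 (fun _ => SSeq (iter m.-1 (fun c => SCase 11 (fun _ => c)) SSkip)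
      (SSeq (SWhile 3 (fun b => SSeq (SPush 12 b) (SPush 12 b))) (sMove 12 3))))
    [:: p; e; t; u; z; k; c; a; x; y; b; n; [::]; [::]; [::]; [::]; [::]; [::]; [::]]
    [:: p; e; t; u'; z; k; c; a; x; y; b; [::]; [::]; [::]; [::]; [::]; [::]; [::]; [::]]
    ((7 * size u' + m + 5) * size n).+1.
Proof.
move=> m0 n; have [N] := ubnP (size n); elim: N n => // N IH [|h n] nN u.
  exists u; rewrite /= add0n divn_small ?muln1 ?muln0; last by lia.
  by split=> //; exact: sev_while_end.
have [d [sd e1]] := double_ok p e t u z k c a x y b (drop m.-1 n) [::].
have nN' : size (drop m.-1 n) < N by rewrite size_drop; move: nN => /=; lia.
have [u' [su' e2]] := IH (drop m.-1 n) nN' (rev d).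
have su : size u' = size u * 2 ^ ((size (h :: n) + m.-1) %/ m).
  rewrite su' size_rev sd addn0 size_drop.
  have -> : (size (h :: n) + m.-1) %/ m = ((size n - m.-1 + m.-1) %/ m).+1.
    rewrite (_ : size (h :: n) + m.-1 = 1 * m + size n); last by rewrite /=; lia.
    rewrite divnMDl // add1n; congr _.+1.
    have [mn|nm] := leqP m.-1 (size n); first by rewrite subnK.
    by rewrite (_ : size n - m.-1 = 0) ?divn_small //; lia.
  by rewrite expnS mulnA [size u * 2]mulnC.
exists u'; split=> //.
eapply sev_le.
  eapply sev_while_step; [done|reflexivity| |exact: e2].
  eapply sev_seq; [exact: pops_ok|].
  eapply sev_seq; [exact: e1|].
  exact: sev_move.
rewrite /= size_drop.
have uu : 2 * size u <= size u'.
  rewrite su mulnC leq_mul2l; apply/orP; right.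
  rewrite -[X in X <= _]expn1 leq_exp2l // divn_gt0 //=; lia.
have : size n - m.-1 <= size n by rewrite leq_subr.
rewrite sd addn0; move: (size n - m.-1) => n1; nia.
Qed.

Lemma main_ok K m (p e t : seq bool) : 0 < m -> 1 < nval p ->
  (forall x, O x < nval p) ->
  (forall x, 0 < x < nval p -> ok ((x + (nval p - nval t)) %% nval p)) ->
  size e <= size p -> size t <= size p -> nval t <= nval p ->
  let U := K * 2 ^ ((size e + m.-1) %/ m) in let L := (size p).+1 in
  exists r', (get r' 18 == [::])
      = all (fun i => passes (nval p) (nval e) (nval p - nval t) (i %% nval p)) (iota 1 U) /\
    sev (sMain K m)
      [:: p; e; t; [::]; [::]; [::]; [::]; [::]; [::]; [::]; [::]; [::]; [::]; [::]; [::]; [::]; [::];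
          [::]; [::]] r' ((1000 + m) * (L * L * L * U.+1)).
Proof.
move=> m0 P1 OP okP ep tp tP U L.
have [u [su e1]] := init_loop p e t [::] [::] [::] [::] [::] [::] [::] m0 e (nseq K true).
rewrite size_nseq -/U in su.
have sp2 : size [:: false; true] <= size p.
  by have := val_lt p; case: (size p) => [|[|]] //; rewrite ?expn0 ?expn1; lia.
have [k [sk vk e2]] := @sub_ok O ok 5 p e t u [::] [::] [::] [::] [::] [:: false; true] [::] [::]
  [::] [::] isT isT sp2 P1.
have [t' [st vt e3]] := @sub_ok O ok 2 p e [::] u [::] k [::] [::] [::] t [::] [::]
  [::] [::] isT isT tp tP.
rewrite /= catrevE revK cats0 in e2.
rewrite /= catrevE revK cats0 in e3.
have tP' : nval t' <= nval p by rewrite vt leq_subr.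
have okP' x : 0 < x < nval p -> ok ((x + nval t') %% nval p) by rewrite vt; apply: okP.
have st' : size t' <= size p by rewrite st.
have sk' : size k <= size p by rewrite sk.
have vk' : nval k = nval p - 2 by rewrite vk.
have [r' [rE e4]] := @main_loop p e t' k P1 OP okP' ep st' sk' tP' vk' u [::] [::] isT (ltnW P1).
exists r'; split.
  rewrite rE vt su /=; apply: eq_all => i; by rewrite add0n.
eapply sev_le.
  rewrite /sMain /sInit /sSeqs.
  eapply sev_seq; last exact: e4.
  eapply sev_seq; [exact: init_push|rewrite cats0].
  step sev_copy. rewrite cats0.
  eapply sev_seq; [exact: e1|].
  step sev_push. step sev_push.
  eapply sev_seq; [exact: e2|].
  step sev_copy. step sev_clear. rewrite cats0.
  exact: e3.
rewrite /= su.
have h1 : L <= L * L by rewrite leq_pmulr.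
have h2 : L * L <= L * L * L by rewrite leq_pmulr.
have KU : K <= U by rewrite leq_pmulr // expn_gt0.
have eL : size e <= L by rewrite (leq_trans ep).
have tL : size t <= L by rewrite (leq_trans tp).
rewrite -/L.
have h3 : (7 * U + m + 5) * size e <= (7 * U + m + 5) * (L * L * L).
  by rewrite leq_mul2l (leq_trans eL) ?orbT // (leq_trans h1).
move: (L * L * L) h2 h3 => L3 h2 h3.
have h4 : U <= L3 * U by rewrite leq_pmull //; lia.
have -> : (1000 + m) * (L3 * U.+1) = 1000 * (L3 * U) + 1000 * L3 + m * (L3 * U) + m * L3 by lia.
have h5 : (7 * U + m + 5) * (L3) = 7 * (L3 * U) + m * L3 + 5 * L3 by lia.
have h6 : 601 * L3 * U = 601 * (L3 * U) by lia.
rewrite h6; rewrite h5 in h3.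
move: ((7 * U + m + 5) * size e) h3 h4 {h5 h6} => X; move: (L3 * U) (m * L3) => Y Z.
lia.
Qed.

End Programs.

(** * The decision machine *)

Definition tNext := TSeq (TWhile (fun _ => tR)) tR.

(** A step left and back creates the blank in front, the walk past the third word creates its
    delimiter, and [k] further blanks are [k] empty stacks. *)
Definition tSetup (k : nat) : tm :=
  TSeq tL (TSeq tR (TSeq (tGoto 2) (TSeq tNext (TSeq (tIter k tNext) (tHome k.+3))))).

Section Setup.
Variables (O : nat -> nat) (ok : pred nat).
Notation ev := (ev O ok).

Lemma ev_next_end s l : ev tNext (touch (Tape l (map Some s)))
  (Tape (None :: rev (map Some s) ++ l) [::]) (2 * (size s).+1).
Proof.
case: s => [|b s]; first exact: (ev_walkR O ok [::] l [::]).
have loop s' l' : ev (TWhile (fun _ => tR)) (Tape l' (map Some s'))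
    (Tape (rev (map Some s') ++ l') [:: None]) (2 * size s').+1.
  elim: s' l' => [|b' s' IH] l'; first exact: (@EvWhileEnd O ok (fun _ => tR) (Tape l' [::]) 1).
  have e1 := ev_do O ok (fun c => (c, MoveR)) l' (Some b') (map Some s').
  rewrite /= rev_cons cat_rcons.
  by apply: (@EvWhileStep O ok _ b' (Tape l' (Some b' :: map Some s')) _ _ 1 _ _ erefl e1 (IH _)); lia.
have e2 := ev_do O ok (fun c => (c, MoveR)) (rev (map Some (b :: s)) ++ l) None [::].
by apply: (EvSeq (loop (b :: s) l) e2); rewrite /=; lia.
Qed.

Lemma ev_nexts k l : ev (tIter k tNext) (Tape l [::]) (Tape (nseq k None ++ l) [:: None]) (2 * k).+1.
Proof.
elim: k l => [|k IH] l; first exact: (@EvDo O ok (fun c => (c, Stay)) (Tape l [::]) 1).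
have e0 := @EvWhileEnd O ok (fun _ => tR) (Tape l [::]) 1 erefl isT.
have e1 := ev_do O ok (fun c => (c, MoveR)) l None [::].
have -> : nseq k.+1 None ++ l = nseq k None ++ (None : option bool) :: l by elim: (k) => //= k' ->.
by apply: (EvSeq (ev_seq e0 e1) (IH (None :: l))); lia.
Qed.

Lemma enc_nil k : enc (nseq k [::]) = nseq k None.
Proof. by elim: k => //= k ->. Qed.

Lemma ev_setup k s1 s2 s3 : ev (tSetup k)
  (Tape [::] (map Some s1 ++ None :: map Some s2 ++ None :: map Some s3))
  (home_tape (s1 :: s2 :: s3 :: nseq k [::]) 1) (4 * (size s1 + size s2 + size s3) + 4 * k + 30).
Proof.
set R := map Some s1 ++ _.
have [x [R' RE]] : exists x R', R = x :: R' by rewrite /R; case: (s1) => [|b s]; do 2 eexists.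
have e1 : ev tL (Tape [::] R) (Tape [::] (None :: R)) 1.
  by rewrite RE; exact: (ev_do O ok (fun c => (c, MoveL)) [::] x R').
have e2 : ev tR (Tape [::] (None :: R)) (Tape [:: None] R) 1.
  exact: (ev_do O ok (fun c => (c, MoveR)) [::] None R).
have e3 := ev_goto O ok [:: s1; s2] [:: None] (map Some s3).
have RE3 : enc [:: s1; s2] ++ map Some s3 = R by rewrite /R /= -!catA /= -catA.
rewrite RE3 in e3.
have e4 := ev_next_end s3 (rev (enc [:: s1; s2]) ++ [:: None]).
have e5 := ev_nexts k (None :: rev (map Some s3) ++ rev (enc [:: s1; s2]) ++ [:: None]).
pose r := s1 :: s2 :: s3 :: nseq k [::].
have rE : nseq k None ++ None :: rev (map Some s3) ++ rev (enc [:: s1; s2]) ++ [:: None]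
    = rev (enc r) ++ [:: None].
  have -> : enc r = enc [:: s1; s2] ++ map Some s3 ++ None :: nseq k None.
    by rewrite /r -enc_nil /= -!catA /= -!catA.
  by rewrite !rev_cat !rev_cons rev_nseq -!catA !cat_rcons.
rewrite rE in e5.
have e6 := ev_home O ok r None [::].
have -> : home_tape r 1 = Tape [:: None] (enc r ++ [:: None]) by [].
have sr : size r = k.+3 by rewrite /r /= size_nseq.
rewrite sr in e6.
apply: (EvSeq e1 (ev_seq e2 (ev_seq e3 (ev_seq e4 (ev_seq e5 e6))))).
by rewrite /r /= enc_nil !size_cat /= !size_cat /= !size_cat /= size_nseq !size_map; lia.
Qed.

End Setup.

(** 16 empty stacks join the three inputs. The head ends on stack 18, where a blank means that no
    test has failed. *)
Definition decider (K m : nat) : OTM :=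
  machine (with_halt (TSeq (tSetup 16) (TSeq (tr 19 (sMain K m)) (tGoto 18)))).

Lemma cost_monomial c l u : 1000 * c ^ 2 * (l ^ 7 * u ^ 2)
  = 1000 * (c * (l * l * l * u) * (c * (l * l * l * u)) * l).
Proof. by rewrite !expnS !expn0 !muln1; lia. Qed.

(** With [N] stack steps on a tape of length [O(N * L)] the machine takes [O(N * N * L)] steps;
    [N = (1000 + m) * L ^ 3 * U.+1] gives the exponents 7 and 2. *)
Lemma decider_ok K m (O : nat -> nat) (ok : pred nat) (p e t : nat) : 0 < m -> 1 < p ->
  (forall x, O x < p) -> (forall x, 0 < x < p -> ok ((x + (p - t)) %% p)) -> e < p -> t < p ->
  let U := K * 2 ^ ((size (bits_of e) + m.-1) %/ m) in let L := (size (bits_of p)).+1 in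
  exists T, T <= 1000 * (1000 + m) ^ 2 * (L ^ 7 * U.+1 ^ 2) /\ exists qs,
    @exec (decider K m) O T (start (decider K m)) (init_tape p e t)
      = Some (all (fun i => passes O p e (p - t) (i %% p)) (iota 1 U), qs) /\ all ok qs.
Proof.
move=> m0 p1 OP okP ep tp U L.
have bits_le n : n < p -> size (bits_of n) <= size (bits_of p) by move/ltnW/size_bits_mono.
have [] := @main_ok O ok K m (bits_of p) (bits_of e) (bits_of t) m0; rewrite ?bits_of_val //.
- exact: bits_le.
- exact: bits_le.
- exact: ltnW.
rewrite -/U -/L => r' [rE e1].
set r := [:: bits_of p, _ & _] in e1.
set N := (1000 + m) * _ in e1.
have WO x : size (bits_of (O x)) <= L.
  by apply: leqW; apply: size_bits_mono; apply: ltnW.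
have [m' e2] := sim (W := L) (ltn0Sn _) WO e1 (erefl 19) 1.
have enc_le := sev_enc (ltn0Sn _) WO e1.
have sr : size r' = 19 := sev_size e1.
have r18 : 18 < size r' by rewrite sr.
have [r1 [r2 [_ _ _ e3]]] := goto_seg O ok m' r18 sr.
have e0 := ev_setup O ok 16 (bits_of p) (bits_of e) (bits_of t).
have evs := ev_seq e0 (ev_seq (e2 _ (leqnn _)) e3).
have [T [TN [qs [ex qok]]]] := exec_with_halt evs.
exists T; split; last first.
  exists qs; split; last exact: qok.
  have rd l R : (read (Tape l (map Some (get r' 18) ++ None :: R)) == None) = (get r' 18 == [::]).
    by case: (get r' 18).
  by move: ex; rewrite rd rE => ex; exact: ex.
have encr : size (enc r) <= 3 * L + 19.
  rewrite /r /= !size_cat /= !size_cat /= !size_cat /= !size_map.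
  by have := bits_le _ ep; have := bits_le _ tp; rewrite /L; lia.
apply: leq_trans TN _.
have tL : size (bits_of t) <= L by apply: leqW; apply: bits_le.
have eL : size (bits_of e) <= L by apply: leqW; apply: bits_le.
have NE : N = (1000 + m) * (L * L * L * U.+1) by [].
have L1 : 1 <= L by [].
have LN : L <= N.
  by rewrite NE mulnCA -!mulnA leq_pmulr // !muln_gt0.
have -> : 1000 * (1000 + m) ^ 2 * (L ^ 7 * U.+1 ^ 2) = 1000 * (N * N * L).
  by rewrite NE cost_monomial.
have er : size (enc r) <= 22 * L by lia.
have er' : size (enc r') <= 22 * L + N * L by lia.
have bitsp : size (bits_of p) <= L by [].
clear -er er' bitsp tL eL L1 LN; clearbody N.
have NL : L <= N * L by rewrite leq_pmull // (leq_trans L1).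
have NNL : N * L <= N * N * L by rewrite leq_mul2r leq_pmulr ?orbT // (leq_trans L1).
have N1 : N <= N * N * L by rewrite -mulnA leq_pmulr // muln_gt0 L1 (leq_trans L1).
have main : N * (10 * (size (enc r) + N * L) + 20) <= 240 * (N * L) + 10 * (N * N * L).
  have : N <= N * L by rewrite leq_pmulr.
  have : N * size (enc r) <= N * (22 * L) by rewrite leq_mul2l er orbT.
  by rewrite !mulnDr; lia.
lia.
Qed.

(** * Correctness of the tests *)

Section Correctness.
Import GRing.Theory.
Local Open Scope ring_scope.

Lemma Fp_nat_mod' (p n : nat) : prime p -> (n %% p)%:R = n%:R :> 'F_p.
Proof. by move=> p_pr; apply: val_inj; rewrite /= !val_Fp_nat // modn_mod. Qed.

Lemma Fp_inv_nat (p z : nat) : prime p -> (z%:R : 'F_p) != 0 ->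
  (z ^ (p - 2) %% p)%:R = (z%:R : 'F_p)^-1.
Proof.
move=> p_pr z0; rewrite Fp_nat_mod' // natrX; apply: (mulfI z0); rewrite divff //.
apply: (mulfI z0); rewrite mulr1 -!exprS.
have -> : (p - 2).+2 = p by have := prime_gt1 p_pr; lia.
by have := expf_card (z%:R : 'F_p); rewrite card_Fp.
Qed.

Lemma all_passes (m : nat) : (0 < m)%N -> exists2 K, (0 < K)%N &
  forall p e s t h : nat, prime p -> (0 < e)%N -> (e %| p.-1)%N ->
    (m = 1)%N \/ (e ^ (16 * m) <= p)%N -> (e < h ^ m <= 2 ^ m.+1 * e)%N -> (s < p)%N -> (t < p)%N ->
  all (fun i => passes (oracle p e s) p e (p - t) (i %% p)) (iota 1 (K * h)) = (s == t).
Proof.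
move=> m0; have [K K0 HK] := exists_translate m0; exists K => // p e s t h p_pr e0 ep em eh sp tp.
have p1 := prime_gt1 p_pr.
case: eqP => [->|/eqP st].
  apply/allP=> i _; rewrite /passes /oracle; apply/orP; right; apply/eqP.
  rewrite -modnXm modnDml -addnA subnK ?(ltnW tp) // modnDr.
  by rewrite modn_mod modnXm.
have a0 : (s%:R - t%:R : 'F_p) != 0.
  by rewrite subr_eq0; apply: contra st => /eqP /Fp_nat_inj ->.
have ep' : (0 < e <= p.-1)%N by rewrite e0 dvdn_leq //; lia.
have [z /andP[z0 zh] za] := HK p e h _ p_pr ep' em eh a0.
apply/negbTE/allPn; exists z; first by rewrite mem_iota; lia.
rewrite modn_small; last by lia.
(* The bound [z <= p.-1] makes [z] invertible mod [p]. *)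
have zF : (z%:R : 'F_p) != 0.
  by apply/eqP=> /(@Fp_nat_inj p z 0 p_pr) zz; move: z0; rewrite zz //; lia.
rewrite /passes negb_or /oracle; set x := (z ^ _ %% p)%N.
have xE : x%:R = (z%:R : 'F_p)^-1 by apply: Fp_inv_nat.
apply/andP; split.
  by apply: contraNneq zF => x0; move: xE; rewrite x0 => /esym/eqP; rewrite invr_eq0.
apply: contraNneq za => /(congr1 (fun n => n%:R : 'F_p)).
rewrite !Fp_nat_mod' // !natrX natrD Fp_nat_mod' // natrD natrB; last exact: ltnW.
have -> : p%:R = 0 :> 'F_p by apply/eqP; rewrite -(dvdn_pcharf (pchar_Fp p_pr)).
rewrite xE sub0r -addrA [_ + s%:R]addrC => eqx.
have -> : 1 + (s%:R - t%:R) * z%:R = (z%:R^-1 + (s%:R - t%:R)) * z%:R :> 'F_p.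
  by rewrite [RHS]mulrDl mulVf.
by rewrite exprMn eqx -exprMn mulVf // expr1n.
Qed.

End Correctness.

(** * The time bound *)

Lemma INR_muln a b : INR (a * b) = (INR a * INR b)%Re.
Proof. by rewrite -mult_INR. Qed.

Lemma INR_expn a b : INR (a ^ b) = (INR a ^ b)%Re.
Proof. by elim: b => //= b IH; rewrite expnS INR_muln IH. Qed.

Lemma INR_leq a b : a <= b -> (INR a <= INR b)%Re.
Proof. by move/leP; apply: le_INR. Qed.

Lemma leq_INR a b : (INR a <= INR b)%Re -> a <= b.
Proof. by move/INR_le/leP. Qed.

Lemma pow_le_inv (x y : R) n : (0 <= y)%Re -> 0 < n -> (x ^ n <= y ^ n)%Re -> (x <= y)%Re.
Proof.
move=> y0 n0 xy; apply: Rnot_lt_le => yx.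
have : (y ^ n < x ^ n)%Re.
  elim: n n0 {xy} => // n IH _; case: (posnP n) => [->|n0]; first by rewrite /=; lra.
  have h := IH n0; have yn : (0 <= y ^ n)%Re by apply: pow_le.
  rewrite /=; apply: (Rle_lt_trans _ (x * y ^ n)%Re); first by apply: Rmult_le_compat_r => //; lra.
  by apply: Rmult_lt_compat_l => //; lra.
lra.
Qed.

Lemma ln_mono x y : (0 < x)%Re -> (x <= y)%Re -> (ln x <= ln y)%Re.
Proof.
move=> x0 [xy|->]; last exact: Rle_refl.
by apply: Rlt_le; apply: ln_increasing.
Qed.

(** The bit length is at most [1 + log2 p]; the remaining 2 is at most [2 log2 p] since [p >= 2],
    whence the constant 3. *)
Lemma size_bits_ln p : 1 < p -> (INR (size (bits_of p)).+1 <= 3 / ln 2 * ln (INR p))%Re.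
Proof.
move=> p1; have ln2 : (0 < ln 2)%Re by rewrite -ln_1; apply: ln_increasing; lra.
have := size_bits_le (ltnW p1); set l := size _ => lp.
have p2 : (2 <= INR p)%Re by have := INR_leq p1; rewrite /=; lra.
have h : (INR l.-1 * ln 2 <= ln (INR p))%Re.
  rewrite -ln_pow; last lra.
  have -> : (2 ^ l.-1 = INR (2 ^ l.-1))%Re by rewrite INR_expn.
  apply: ln_mono; last exact: INR_leq.
  rewrite INR_expn; apply: pow_lt; rewrite /=; lra.
have h2 : (ln 2 <= ln (INR p))%Re by apply: ln_mono => //; lra.
have h3 : (INR l.+1 <= INR l.-1 + 2)%Re.
  have -> : (2 = INR 2)%Re by [].
  by rewrite -plus_INR; apply: INR_leq; rewrite plusE; lia.
apply: (Rmult_le_reg_r (ln 2)) => //.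
rewrite -[(3 / ln 2 * ln (INR p) * ln 2)%Re]/(3 / ln 2 * ln (INR p) * ln 2)%Re.
have -> : (3 / ln 2 * ln (INR p) * ln 2 = 3 * ln (INR p))%Re by field; lra.
have : (INR l.+1 * ln 2 <= (INR l.-1 + 2) * ln 2)%Re by apply: Rmult_le_compat_r => //; lra.
lra.
Qed.

(** For [delta < 1/32], [m] is the integer part of [y = 1 / (16 delta) > 2], so [m > y / 2]; this
    loses the factor 2 between 16 and 32. *)
Lemma exponent_choice (delta : R) : (0 < delta)%Re -> exists m : nat,
  [/\ 0 < m, m = 1 \/ (16 * INR m * delta <= 1)%Re & (/ INR m <= 32 * delta)%Re].
Proof.
move=> d0; case: (Rle_lt_dec (/32) delta) => [d1|d1].
  by exists 1; split; [|left|rewrite /=; lra].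
pose y := (/ (16 * delta))%Re.
have yd : (y * (16 * delta) = 1)%Re by rewrite /y; field; lra.
have y2 : (2 < y)%Re.
  by apply: (Rmult_lt_reg_r (16 * delta)); rewrite ?yd; lra.
have [n [ny yn]] : exists n : nat, (INR n <= y)%Re /\ (y < INR n + 1)%Re.
  have [h1 h2] := archimed y.
  have h3 : (0 <= up y - 1)%Zs by apply: (proj1 (Z.lt_succ_r _ _)); apply: lt_IZR; rewrite succ_IZR minus_IZR; lra.
  exists (Z.to_nat (up y - 1)); rewrite INR_IZR_INZ Znat.Z2Nat.id // minus_IZR; lra.
have n1 : (1 < INR n)%Re by lra.
have n0 : 0 < n by case: (n) n1 => //=; lra.
exists n; split=> //.
  by right; have : (INR n * (16 * delta) <= y * (16 * delta))%Re; [apply: Rmult_le_compat_r; lra|lra].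
apply: (Rmult_le_reg_r (INR n)); first by lra.
rewrite Rinv_l; last lra.
have : (y / 2 * (16 * delta) <= INR n * (16 * delta))%Re by apply: Rmult_le_compat_r; lra.
lra.
Qed.

(** Rounding the bit length [l] up to a multiple of [m] costs at most [2 ^ m.-1], and
    [2 ^ l <= 2 * e]. *)
Lemma root_size_bounds m e : 0 < m -> 0 < e ->
  e < (2 ^ ((size (bits_of e) + m.-1) %/ m)) ^ m <= 2 ^ m.+1 * e.
Proof.
move=> m0 e0; set l := size _; set q := _ %/ _.
have l0 : 0 < l.
  by have := size_bits_ge e; rewrite -/l; case: (l) => //; rewrite expn0; lia.
have qm : l + m.-1 < (q + 1) * m by rewrite addn1 /q ltn_ceil.
have qm' : q * m <= l + m.-1 by rewrite /q leq_trunc_div.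
rewrite -expnM; apply/andP; split.
  by apply: leq_trans (size_bits_ge e) _; rewrite leq_exp2l // -/l; lia.
apply: (@leq_trans (2 ^ (m + l.-1))); first by rewrite leq_exp2l //; lia.
rewrite expnD leq_mul ?size_bits_le // leq_exp2l //.
Qed.

Lemma small_order_power (delta : R) m p e : 1 < p -> 0 < e -> 0 < m ->
  (16 * INR m * delta <= 1)%Re -> (INR e <= Rpower (INR p) delta)%Re -> e ^ (16 * m) <= p.
Proof.
move=> p1 e0 m0 md ep; apply: leq_INR.
have p2 : (2 <= INR p)%Re by have := INR_leq p1; rewrite /=; lra.
rewrite INR_expn.
apply: (Rle_trans _ (Rpower (INR p) delta ^ (16 * m))%Re).
  by apply: pow_incr; split=> //; apply: pos_INR.
rewrite -Rpower_pow; last exact: exp_pos.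
rewrite Rpower_mult -[X in (_ <= X)%Re](Rpower_1 (INR p)); last lra.
apply: Rle_Rpower; first lra.
rewrite INR_muln; have -> : INR 16 = 16%Re by rewrite /=; lra.
lra.
Qed.

(** The constant 4 comes from [2 ^ m.+1 <= 4 ^ m]. *)
Lemma root_le (m e h : nat) : 0 < m -> 0 < e -> h ^ m <= 2 ^ m.+1 * e ->
  (INR h <= 4 * Rpower (INR e) (/ INR m))%Re.
Proof.
move=> m0 e0 he.
have e1 : (1 <= INR e)%Re by apply: (INR_leq e0).
have m1 : (1 <= INR m)%Re by apply: (INR_leq m0).
have R0 := exp_pos (/ INR m * ln (INR e)); rewrite -/(Rpower _ _) in R0.
apply: (@pow_le_inv _ _ m) => //; first lra.
rewrite -INR_expn Rpow_mult_distr -[X in (_ <= _ * X)%Re]Rpower_pow //.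
rewrite Rpower_mult Rinv_l; last lra.
rewrite Rpower_1; last lra.
apply: (Rle_trans _ _ _ (INR_leq he)); rewrite INR_muln INR_expn.
apply: Rmult_le_compat_r; first lra.
have -> : (4 ^ m = INR 2 ^ (2 * m))%Re by rewrite pow_mult; congr (_ ^ _)%Re; rewrite /=; lra.
apply: Rle_pow; first by rewrite /=; lra.
by apply/leP; rewrite -multE; lia.
Qed.

Theorem theorem3p10 :
  exists c0 : R,
  forall delta : R, Rlt 0 delta ->
  exists (M : OTM) (C : R) (k : nat),
  forall p e s t : nat,
    prime p -> 0 < e -> e %| p.-1 -> Rle (INR e) (Rpower (INR p) delta) ->
    s < p -> t < p ->
    exists T : nat,
      Rle (INR T) (Rmult (Rmult C (Rpower (INR e) (Rmult c0 delta))) (pow (ln (INR p)) k)) /\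
      exists qs : seq nat,
        @exec M (oracle p e s) T (start M) (init_tape p e t) = Some (s == t, qs) /\
        all (fun x => ~~ forbidden p t x) qs.
Proof.
(* [64 = 2 * 32]: the loop length enters the time squared, and [1/m <= 32 delta]. *)
exists 64%Re => delta d0.
have [m [m0 md minv]] := exponent_choice d0.
have [K K0 HK] := all_passes m0.
pose c := (3 / ln 2)%Re.
pose A := 1000 * (1000 + m) ^ 2.
(* [8 * INR K] comes from [(K * h).+1 <= 2 * K * h] and [h <= 4 e ^ (1/m)]; the powers 7 and 2 are
   those of the machine's cost. *)
exists (decider K m), (INR A * c ^ 7 * (8 * INR K) ^ 2)%Re, 7 => p e s t p_pr e0 ediv ep sp tp.
have p1 := prime_gt1 p_pr.
have elt : e < p.
  have : e <= p.-1 by apply: dvdn_leq => //; lia.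
  lia.
have hb := root_size_bounds m0 e0.
set h := 2 ^ _ in hb.
have em : m = 1 \/ e ^ (16 * m) <= p.
  by case: md => [|md]; [left|right; apply: small_order_power ep].
have Olt x : oracle p e s x < p by rewrite /oracle ltn_mod; lia.
have okP x : 0 < x < p -> ~~ forbidden p t ((x + (p - t)) %% p).
  move=> /andP[x0 xp]; rewrite /forbidden modnDml -addnA subnK ?(ltnW tp) // modnDr modn_small //; lia.
have := @decider_ok K m (oracle p e s) (fun x => ~~ forbidden p t x) p e t m0 p1 Olt okP elt tp.
rewrite -/h => -[T [TN [qs [ex qok]]]].
rewrite (HK p e s t h p_pr e0 ediv em hb sp tp) in ex.
exists T; split; last by exists qs.
set L := (size (bits_of p)).+1 in TN.
have LN : (INR L <= c * ln (INR p))%Re by apply: size_bits_ln.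
have /andP[_ he] := hb.
have hN := root_le m0 e0 he.
have h0 : 0 < h by rewrite expn_gt0.
have Kh : (K * h).+1 <= 2 * K * h.
  have : 0 < K * h by rewrite muln_gt0 K0.
  by rewrite -mulnA; move: (K * h) => x; lia.
apply: (Rle_trans _ _ _ (INR_leq TN)).
rewrite -/A INR_muln INR_muln !INR_expn.
have K1 : (1 <= INR K)%Re by apply: (INR_leq K0).
have e1 : (1 <= INR e)%Re by apply: (INR_leq e0).
have m1 : (1 <= INR m)%Re by apply: (INR_leq m0).
have uN : (INR (K * h).+1 <= 8 * INR K * Rpower (INR e) (/ INR m))%Re.
  apply: (Rle_trans _ _ _ (INR_leq Kh)); rewrite !INR_muln.
  have -> : INR 2 = 2%Re by [].
  have : (2 * INR K * INR h <= 2 * INR K * (4 * Rpower (INR e) (/ INR m)))%Re.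
    by apply: Rmult_le_compat_l => //; lra.
  lra.
have u2 : (INR (K * h).+1 ^ 2 <= (8 * INR K) ^ 2 * Rpower (INR e) (64 * delta))%Re.
  apply: (Rle_trans _ ((8 * INR K * Rpower (INR e) (/ INR m)) ^ 2)%Re).
    by apply: pow_incr; split=> //; apply: pos_INR.
  rewrite Rpow_mult_distr; apply: Rmult_le_compat_l; first by apply: pow2_ge_0.
  rewrite -Rpower_pow; last exact: exp_pos.
  rewrite Rpower_mult; apply: Rle_Rpower => //.
  rewrite /=; lra.
have L7 : (INR L ^ 7 <= c ^ 7 * ln (INR p) ^ 7)%Re.
  by rewrite -Rpow_mult_distr; apply: pow_incr; split=> //; apply: pos_INR.
have A0 : (0 <= INR A)%Re by apply: pos_INR.
have L0 : (0 <= INR L ^ 7)%Re by apply: pow_le; apply: pos_INR.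
have u0 : (0 <= INR (K * h).+1 ^ 2)%Re by apply: pow2_ge_0.
have := Rmult_le_compat_l _ _ _ A0 (Rmult_le_compat _ _ _ _ L0 u0 L7 u2).
set X := Rpower _ _; set Y := (ln _ ^ 7)%Re; set W := ((8 * _) ^ 2)%Re.
lra.
Qed.
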